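(* Assume that $P(\phi_0=1)<1$ and that for some $\alpha>0$ there exists $h:(0,\infty)\to\mathbb{R}$, regularly varying with index $\alpha$, such that $\lim_{t\to\infty}h(t)\,P(Z_0>t)=1$ and $\sup_{t>0}h(t)\,P(Z_0>t)<\infty$. For $n\in\mathbb{N}$ let $M_n=\max\{X_1,\dots,X_n\}$ and $b_n=\inf\{t>0:h(t)\ge n\}$. Then, under $P_0$, $M_n/b_n$ converges in distribution, as $n\to\infty$, to a proper random variable $M_\infty$ with distribution function $$P_0(M_\infty\le x)=e^{-x^{-\alpha}},\qquad x>0.$$
   Context: Notation: $\mathbb{N}=\{1,2,\dots\}$, $\mathbb{Z}_+=\{0,1,2,\dots\}$. A function $h$ is regularly varying with index $\alpha\in\mathbb{R}$ if $h(t)=t^\alpha L(t)$ with $\lim_{t\to\infty}L(\lambda t)/L(t)=1$ for all $\lambda>0$. Model: $\Phi=(\phi_n)_{n\in\mathbb{Z}}$ is an i.i.d. sequence of $[0,1]$-valued random variables; $(Z_n)_{n\in\mathbb{Z}}$ is an i.i.d. sequence of $\mathbb{Z}_+$-valued random variables, independent of $\Phi$. Let $P_\Phi$ denote the conditional probability given $\Phi$. $B=(B_{n,k})_{n,k\in\mathbb{Z}}$ is a collection of Bernoulli variables such that $(\Phi,B)$ is independent of $(Z_n)_{n\in\mathbb{Z}}$ and, given $\Phi$, the $B_{n,k}$ are independent with $P_\Phi(B_{n,k}=1)=\phi_n$, $P_\Phi(B_{n,k}=0)=1-\phi_n$. The RCINAR(1) process $(X_n)_{n\in\mathbb{Z}_+}$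 is defined by $X_0=0$ and $$X_n=\sum_{k=1}^{X_{n-1}}B_{n,k}+Z_n,\qquad n\in\mathbb{N},$$ where an empty sum is zero. $P_0$ denotes the joint law of all these objects with $X_0=0$. *)

(* Defs.v *)
From HB Require Import structures.
From mathcomp Require Export all_boot all_order all_algebra finmap.
From mathcomp Require Export all_classical all_reals all_analysis.

Set Implicit Arguments.
Unset Strict Implicit.
Unset Printing Implicit Defensive.

Export Order.TTheory GRing.Theory Num.Theory.
Export numFieldNormedType.Exports.


Local Open Scope classical_set_scope.
Local Open Scope ring_scope.

Section independence.
Context d (T : measurableType d) (R : realType) (P : probability T R).

Definition sigma_rv d' (T' : measurableType d') (X : T -> T') : set_system T :=
  preimage_set_system [set: T] X measurable.

Definition sigma_family d' (T' : measurableType d') (K : Type)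
    (X : K -> T -> T') : set_system T :=
  <<s \bigcup_(i in [set: K]) sigma_rv (X i) >>.

Definition indep_systems (F G : set_system T) : Prop :=
  forall A B, F A -> G B -> P (A `&` B) = (P A * P B)%E.

Definition mutual_indep (K : choiceType) (F : K -> set_system T) : Prop :=
  forall (I : {fset K}) (E : K -> set T),
    (forall i, i \in I -> F i (E i)) ->
    P (\bigcap_(i in [set` I]) E i) = (\prod_(i <- I) P (E i))%E.

Definition identically_distributed d' (T' : measurableType d') (K : Type)
    (X : K -> {RV P >-> T'}) : Prop :=
  forall (i j : K) (A : set T'), measurable A ->
    distribution P (X i) A = distribution P (X j) A.

Definition iid d' (T' : measurableType d') (K : choiceType)
    (X : K -> {RV P >-> T'}) : Prop :=
  mutual_indep (fun i => sigma_rv (X i)) /\ identically_distributed X.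

(* g is a version of the conditional probability P(E | G),
   for a sub-sigma-algebra G *)
Definition is_cond_prob (G : set_system T) (E : set T) (g : T -> R) : Prop :=
  [/\ forall Y : set R, measurable Y -> G (g @^-1` Y),
      P.-integrable [set: T] (EFin \o g)
    & forall A, G A -> (\int[P]_(w in A) (g w)%:E = P (A `&` E))%E].

(* Conditional probabilities are unique only almost surely; quantifying over
   all versions is harmless because the conclusion is about versions too. *)
Definition cond_mutual_indep (G : set_system T) (K : choiceType)
    (F : K -> set_system T) : Prop :=
  forall (I : {fset K}) (E : K -> set T) (g : K -> T -> R),
    (forall i, i \in I -> F i (E i) /\ is_cond_prob G (E i) (g i)) ->
    is_cond_prob G (\bigcap_(i in [set` I]) E i)
      (fun w => \prod_(i <- I) g i w).

Definition cvg_in_distribution d' (T' : measurableType d')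
    (P' : probability T' R) (X : nat -> {RV P >-> R}) (Y : {RV P' >-> R}) :
    Prop :=
  forall x : R, {for x, continuous (cdf Y)} ->
    cdf (X n) x @[n --> \oo] --> cdf Y x.

End independence.

(* h is only constrained on the open half-line of positive reals. *)
Definition regularly_varying (R : realType) (alpha : R) (h : R -> R) : Prop :=
  exists L : R -> R,
    (forall t : R, 0 < t -> h t = t `^ alpha * L t) /\
    (forall lambda : R, 0 < lambda ->
      L (lambda * t) / L t @[t --> +oo] --> (1 : R)).

Section rcinar.
Context d (T : measurableType d) (R : realType) (P : probability T R).

(* The conditional law given phi is expressed by conditional probabilities with
   respect to the sigma-algebra generated by the whole sequence phi. *)
Record rcinar_model (phi : int -> {RV P >-> R})
    (B : int -> int -> {RV P >-> bool}) (Z : int -> {RV P >-> nat}) : Prop := {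
  phi_unit_interval : forall n w, 0 <= phi n w <= 1 ;
  phi_iid : iid phi ;
  Z_iid : iid Z ;
  Z_phi_indep : indep_systems P (sigma_family Z) (sigma_family phi) ;
  phiB_Z_indep : indep_systems P
    <<s sigma_family phi `|`
        sigma_family (fun nk : int * int => B nk.1 nk.2 : T -> bool) >>
    (sigma_family Z) ;
  B_cond_indep : cond_mutual_indep P (sigma_family phi)
    (fun nk : int * int => sigma_rv (B nk.1 nk.2)) ;
  B_cond_prob1 : forall n k,
    is_cond_prob P (sigma_family phi) [set w | B n k w = true] (phi n) ;
  B_cond_prob0 : forall n k,
    is_cond_prob P (sigma_family phi) [set w | B n k w = false]
      (fun w => 1 - phi n w) }.

Section process.
Variables (B : int -> int -> {RV P >-> bool}) (Z : int -> {RV P >-> nat}).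

(* the booleans B n k w are coerced to 0 and 1 *)
Fixpoint rcinar (n : nat) (w : T) : nat :=
  if n is m.+1 then
    (\sum_(1 <= k < (rcinar m w).+1) B n%:Z k%:Z w + Z n%:Z w)%N
  else 0%N.

Definition rcinar_max (n : nat) (w : T) : nat :=
  (\max_(1 <= i < n.+1) rcinar i w)%N.

Lemma measurable_nat_comp2 (f g : T -> nat)
    (op : nat -> nat -> nat) :
  measurable_fun setT f -> measurable_fun setT g ->
  measurable_fun setT (fun w => op (f w) (g w)).
Proof.
move=> mf mg _ A _; rewrite setTI.
rewrite (_ : _ @^-1` _ = \bigcup_i (\bigcup_j ((f @^-1` [set i] `&` g @^-1` [set j])
    `&` [set _ | A (op i j)]))); last first.
  apply/seteqP; split=> [w /= Aw|w /= [i _ [j _ [[<- <-]]]]//].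
  by exists (f w) => //; exists (g w).
apply: bigcup_measurable => i _; apply: bigcup_measurable => j _.
apply: measurableI.
  by apply: measurableI; rewrite -[X in measurable X]setTI; [exact: mf|exact: mg].
by case: (pselect (A (op i j))) => H;
  [rewrite (_ : [set _ | _] = setT)//|rewrite (_ : [set _ | _] = set0)//];
  apply/seteqP; split.
Qed.

Lemma measurable_rcinar (n : nat) : measurable_fun setT (rcinar n).
Proof.
elim: n => [|n IH]; first exact: measurable_cst.
have mS (m : nat) : measurable_fun setT
    (fun w => (\sum_(1 <= k < m.+1) B n.+1%:Z k%:Z w)%N).
  elim: m => [|m IHm].
    rewrite (_ : (fun _ => _) = cst 0%N); first exact: measurable_cst.
    by apply/funext => w; rewrite big_geq.
  rewrite (_ : (fun _ => _) = (fun w =>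
    (\sum_(1 <= k < m.+1) B n.+1%:Z k%:Z w + B n.+1%:Z m.+1%:Z w)%N)).
    apply: (measurable_nat_comp2 addn) => //.
    by apply: (measurableT_comp (f := nat_of_bool)) => //.
  by apply/funext => w; rewrite big_nat_recr.
apply: (measurable_nat_comp2 addn); last exact: measurable_funP.
move=> _ A mA; rewrite setTI.
rewrite (_ : _ @^-1` _ = \bigcup_m (rcinar n @^-1` [set m] `&`
   (fun w => (\sum_(1 <= k < m.+1) B n.+1%:Z k%:Z w)%N) @^-1` A)); last first.
  apply/seteqP; split=> [w /= Aw|w /= [m _ [<-]]//].
  by exists (rcinar n w).
apply: bigcup_measurable => m _.
by apply: measurableI; rewrite -[X in measurable X]setTI; [exact: IH|exact: mS].
Qed.

Lemma measurable_rcinar_max (n : nat) : measurable_fun setT (rcinar_max n).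
Proof.
elim: n => [|n IH].
  rewrite (_ : rcinar_max 0 = cst 0%N); first exact: measurable_cst.
  by apply/funext => w; rewrite /rcinar_max big_geq.
rewrite (_ : rcinar_max n.+1 = fun w => maxn (rcinar_max n w) (rcinar n.+1 w)).
  exact: (measurable_nat_comp2 maxn IH (@measurable_rcinar n.+1)).
by apply/funext => w; rewrite /rcinar_max big_nat_recr.
Qed.

Definition scaled_max (b : R) (n : nat) (w : T) : R := (rcinar_max n w)%:R / b.

Lemma measurable_scaled_max (b : R) (n : nat) :
  measurable_fun setT (scaled_max b n).
Proof.
apply: (measurableT_comp (f := fun m : nat => m%:R / b : R)) => //.
exact: measurable_rcinar_max.
Qed.

HB.instance Definition _ (b : R) (n : nat) :=
  isMeasurableFun.Build _ _ _ _ (scaled_max b n) (measurable_scaled_max b n).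

End process.
End rcinar.

(* The infimum of the empty set is 0 in the library; the set below is nonempty
   and b_n is positive for large n whenever h tends to +oo and is bounded above
   on bounded sets. *)
Definition norming (R : realType) (h : R -> R) (n : nat) : R :=
  inf [set t : R | 0 < t /\ n%:R <= h t].

(* Main.v *)
From HB Require Import structures.
Require Import Defs.
From mathcomp Require Import measurable_realfun zify ring lra.

Set Implicit Arguments.
Unset Strict Implicit.
Unset Printing Implicit Defensive.

Local Open Scope classical_set_scope.
Local Open Scope ring_scope.

(** The maximum of the process behaves like the maximum of the immigration
    alone. Write [F t] for the tail [P (Z > t)]. Since [h] is equivalent to
    [1 / F], the norming satisfies [n F (y b_n) --> y ^ -alpha] for all [y > 0]
    (lemma [norming_tail]), so the maximum of [n] independent immigrations,
    scaled by [b_n], has the Frechet limit; and [X_n >= Z_n] gives one half of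
    the theorem.

    For the other half, fix a level [u = x b_n]. Let [X^v] be the process driven
    by the same coins, but whose immigrations above [v] are discarded. A purely
    pathwise argument (lemma [thinned_chain_no_exceedance]) shows that if all
    immigrations stay below [u - 2a], then the process can only exceed [u] when
    either [X^v] exceeds [a] at some time, or an immigration above [v] arrives
    while [X^u] exceeds [a]. Both events are rare by Markov's inequality once the
    moments of a truncated process are bounded by those of one truncated
    immigration, uniformly in time: [E (X^v_n)^p <= K E (Z^p; Z <= v)]. This holds
    (lemma [truncated_rcinar_moment]) because a thinning [S] of [m] individuals
    satisfies [S^p <= m^(p-1) S], so that a generation contracts the [p]-th moment
    by the factor [E phi_0 < 1]. For [p > alpha] the truncated moment is of order
    [v^p F v] (lemma [truncated_moment_tail]). With [v = l u] and [a = r u] the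
    first event has probability of order [r^-p l^(p - alpha)], which is small with
    [l], and the second one is [n F v] times a quantity that tends to [0]. Finally
    [r] tends to [0].

    The only independence used is that a coin of generation [n] is independent of
    the earlier coins and of all the immigration, with success probability
    [E phi_0] (lemma [history_coin_indep]), and that an immigration is independent
    of everything else (lemma [surroundings_immigration_indep]). The first point
    is where the random environment is averaged out: by conditional independence
    the probability of a cylinder of coins is the mean of a product of functions
    of the [phi_j], from which [phi_n] factors out. *)

(** * Pathwise comparison *)

Section pathwise.
Local Open Scope nat_scope.
Variable b : nat -> nat -> bool.

(** The process for deterministic coins [b] and immigrations [z]: keeping both as
    arguments allows the same coins to drive different immigrations. *)
Fixpoint thinned_chain (z : nat -> nat) (n : nat) : nat :=
  if n is m.+1 then
    \sum_(1 <= k < (thinned_chain z m).+1) b n k + z n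
  else 0.

Lemma thinning_le (x m : nat) : \sum_(1 <= k < m.+1) b x k <= m.
Proof.
apply: (@leq_trans (\sum_(1 <= k < m.+1) 1)).
  by apply: leq_sum => k _; case: (b x k).
by rewrite sum_nat_const_nat subn1 muln1.
Qed.

Lemma thinned_chain_ge (z : nat -> nat) n : 0 < n -> z n <= thinned_chain z n.
Proof. by case: n => // n _ /=; rewrite leq_addl. Qed.

Lemma thinned_chain_eq (z z' : nat -> nat) n :
  (forall j, 0 < j <= n -> z j = z' j) -> thinned_chain z n = thinned_chain z' n.
Proof.
elim: n => //= n IH zz'; rewrite IH ?zz' ?leqnn// => j /andP[j0 jn].
by apply: zz'; rewrite j0 ltnW.
Qed.

Lemma thinned_chain_bound (z : nat -> nat) (v n : nat) :
  (forall j, z j <= v) -> thinned_chain z n <= n * v.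
Proof.
move=> zv; elim: n => //= n IH; rewrite mulSn addnC leq_add//.
exact: leq_trans (thinning_le _ _) IH.
Qed.

(** The extra individuals caused by extra immigrants are themselves thinned, so
    their number grows by at most the extra immigration. *)
Lemma thinned_chain_increment (z z' : nat -> nat) n :
  (forall j, z' j <= z j) ->
  thinned_chain z' n <= thinned_chain z n /\
  thinned_chain z n.+1 - thinned_chain z' n.+1 <=
    (thinned_chain z n - thinned_chain z' n) + (z n.+1 - z' n.+1).
Proof.
move=> zz.
have split_sum m x y : x <= y ->
    \sum_(1 <= k < y.+1) b m k =
    \sum_(1 <= k < x.+1) b m k + \sum_(x.+1 <= k < y.+1) b m k.
  by move=> xy; rewrite -big_cat_nat.
have le_chain : thinned_chain z' n <= thinned_chain z n.
  elim: n => //= n IH; rewrite (split_sum n.+1 _ _ IH).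
  by apply: leq_add => //; rewrite leq_addr.
split=> //=; rewrite (split_sum n.+1 _ _ le_chain).
have : \sum_((thinned_chain z' n).+1 <= k < (thinned_chain z n).+1) b n.+1 k
    <= thinned_chain z n - thinned_chain z' n.
  apply: (@leq_trans
    (\sum_((thinned_chain z' n).+1 <= k < (thinned_chain z n).+1) 1)).
    by apply: leq_sum => k _; case: (b _ _).
  by rewrite sum_nat_const_nat subSS muln1.
by have := zz n.+1; lia.
Qed.

End pathwise.

(** Large values are discarded rather than capped, so that a truncated process
    ignores the corresponding immigrations altogether. *)
Definition truncate (R : realType) (v : R) (m : nat) : nat :=
  if (m%:R <= v)%R then m else 0%N.

Lemma truncate_le (R : realType) (v : R) (m : nat) : (truncate v m <= m)%N.
Proof. by rewrite /truncate; case: ifP. Qed.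

Lemma truncate_ler (R : realType) (v : R) (m : nat) :
  0 <= v -> (truncate v m)%:R <= v.
Proof. by move=> v0; rewrite /truncate; case: ifP. Qed.

(** Single big jump, path by path: a level [u] can only be exceeded if one
    immigration does it almost alone, or if the small immigrations accumulate,
    or if a large immigration hits a population which is already large. *)
Lemma thinned_chain_no_exceedance (R : realType) (b : nat -> nat -> bool)
    (z : nat -> nat) (n : nat) (u v a : R) :
  0 <= a -> a + a <= u ->
  (forall i, (0 < i <= n)%N -> (z i)%:R <= u - (a + a)) ->
  (forall i, (0 < i <= n)%N ->
     (thinned_chain b (fun j => truncate v (z j)) i)%:R <= a) ->
  (forall i, (i < n)%N -> v < (z i.+1)%:R ->
     (thinned_chain b (fun j => truncate u (z j)) i)%:R <= a) ->
  forall i, (i <= n)%N -> (thinned_chain b z i)%:R <= u.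
Proof.
move=> a0 au zu small large.
have a_le_u : a <= u by apply: le_trans au; rewrite lerDl.
set s := fun j => truncate v (z j).
(* the excess over the small process only grows when a large immigration comes,
   and then it is at most the old population plus that immigration *)
have excess i : (i <= n)%N ->
    (thinned_chain b z i - thinned_chain b s i)%N%:R <= u - a.
  elim: i => [_|i IH lin]; first by rewrite subn0 /= subr_ge0.
  have [_ step] := @thinned_chain_increment b z s i (fun j => truncate_le v (z j)).
  have [zv|vz] := leP (z i.+1)%:R v.
    have sz : s i.+1 = z i.+1 by rewrite /s /truncate zv.
    apply: le_trans (IH (ltnW lin)); rewrite ler_nat.
    by rewrite sz subnn addn0 in step.
  have xa : (thinned_chain b z i)%:R <= a.
    rewrite (@thinned_chain_eq b z (fun j => truncate u (z j))) ?large//.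
    move=> j /andP[j0 ji]; rewrite /truncate ifT//.
    apply: le_trans (zu j _) _; first by rewrite j0 (leq_trans ji (ltnW lin)).
    by rewrite lerBlDr lerDl addr_ge0.
  apply: (@le_trans _ _ ((thinned_chain b z i)%:R + (z i.+1)%:R)).
    rewrite -natrD ler_nat (leq_trans step)// leq_add// leq_subr//.
  by apply: le_trans (lerD xa (zu i.+1 _)) _ => //; lra.
move=> [|i] lin; first by apply: le_trans a_le_u.
have [le1 _] := @thinned_chain_increment b z s i.+1 (fun j => truncate_le v (z j)).
rewrite -(subnK le1) natrD -(subrK a u) lerD ?excess//.
by apply: small; rewrite lin.
Qed.

(** * Independence of generated sigma-algebras *)

Section pi_systems.
Context d (T : measurableType d) (R : realType) (P : probability T R).

(** Dynkin's pi-lambda theorem: the events that satisfy the product rule with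
    [A] form a lambda-system. *)
Lemma indep_g_sigma (G : set_system T) (A : set T) :
  setI_closed G -> G `<=` measurable -> measurable A ->
  (forall C, G C -> P (C `&` A) = (P C * P A)%E) ->
  forall C, <<s G >> C -> P (C `&` A) = (P C * P A)%E.
Proof.
move=> GI Gm mA PG.
suff : <<s G >> `<=` [set C | measurable C /\ P (C `&` A) = (P C * P A)%E].
  by move=> + C GC => /(_ _ GC)[].
apply: lambda_system_subset; [by []| |by move=> C GC; split; [exact: Gm|exact: PG]|by []].
apply/dynkin_lambda_system; split.
- by split => //; rewrite setTI probability_setT mul1e.
- move=> C [mC PC]; split; first exact: measurableC.
  rewrite setIC -setDE measureD//; last first.
    by rewrite -ge0_fin_numE// fin_num_measure.
  rewrite (setIC A C) [X in (_ - X)%E]PC probability_setC// -[X in (X - _ = _)%E]mul1e muleBl//.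
  by rewrite fin_num_measure.
- move=> F tF HF.
  have mF i : measurable (F i) by have [] := HF i.
  split; first exact: bigcup_measurable.
  rewrite setI_bigcupl measure_semi_bigcup//; last 3 first.
    by move=> i; apply: measurableI.
    exact: trivIset_setIr.
    by apply: bigcup_measurable => i _; apply: measurableI.
  rewrite measure_semi_bigcup//; last exact: bigcup_measurable.
  rewrite -[(P A)]fineK ?fin_num_measure// muleC -nneseriesZl//.
  apply: eq_eseriesr => i _; have [_ PF] := HF i.
  by rewrite [LHS]PF fineK ?fin_num_measure// muleC.
Qed.

(** The pi-system that generates the join of the set systems [F i], [i] in [D]. *)
Definition cylinders (K : choiceType) (F : K -> set_system T) (D : set K) :
    set_system T :=
  [set A | exists (I : {fset K}) (E : K -> set T),
     (forall i, i \in I -> D i /\ F i (E i)) /\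
     A = \bigcap_(i in [set` I]) E i].

Lemma cylinders_setI (K : choiceType) (F : K -> set_system T) (D : set K) :
  (forall i, setI_closed (F i)) -> (forall i, F i setT) ->
  setI_closed (cylinders F D).
Proof.
move=> FI FT _ _ [I [E [IE ->]]] [J [E' [JE' ->]]].
exists (I `|` J)%fset.
exists (fun i => (if i \in I then E i else setT) `&`
                 (if i \in J then E' i else setT)); split.
  move=> i; rewrite in_fsetU => /orP[|] i_in.
    have [Di FE] := IE _ i_in; split => //.
    by rewrite i_in; apply: FI => //; case: ifP => // /JE'[].
  have [Di FE] := JE' _ i_in; split => //.
  by rewrite i_in; apply: FI => //; case: ifP => // /IE[].
apply/seteqP; split=> [w [wE wE'] i /= _|w wEE'].
  by split; case: ifP => // iI; [exact: wE|exact: wE'].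
split=> i /= i_in.
  by have := wEE' i; rewrite /= in_fsetU i_in => /(_ isT)[].
by have := wEE' i; rewrite /= in_fsetU i_in orbT => /(_ isT)[].
Qed.

Lemma cylinders_measurable (K : choiceType) (F : K -> set_system T) (D : set K) :
  (forall i, F i `<=` measurable) -> cylinders F D `<=` measurable.
Proof.
move=> Fm _ [I [E [IE ->]]]; apply: fin_bigcap_measurable => // i /= iI.
by have [_ /Fm] := IE _ iI.
Qed.

Lemma sub_cylinders (K : choiceType) (F : K -> set_system T) (D : set K) i :
  D i -> F i `<=` cylinders F D.
Proof.
move=> Di A FA; exists [fset i]%fset, (fun=> A); split.
  by move=> j; rewrite in_fset1 => /eqP ->.
by rewrite set_fset1 bigcap_set1.
Qed.

Lemma cylinders_setT (K : choiceType) (F : K -> set_system T) (D : set K) :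
  cylinders F D setT.
Proof.
by exists fset0, (fun=> setT); split => //; rewrite set_fset0 bigcap_set0.
Qed.

Lemma mutual_indep_cylinders (K : choiceType) (F : K -> set_system T)
    (D : set K) i A C :
  mutual_indep P F -> ~ D i -> F i A -> cylinders F D C ->
  P (C `&` A) = (P C * P A)%E.
Proof.
move=> indepF nDi FA [I [E [IE ->]]].
have iI : i \notin I by apply/negP => /IE[].
pose E' j := if j == i then A else E j.
have E'i : E' i = A by rewrite /E' eqxx.
have EE' j : j \in I -> E' j = E j.
  by rewrite /E'; case: eqP => // -> iI'; rewrite iI' in iI.
have := indepF (i |` I)%fset E'.
rewrite big_fsetU1//= E'i => H.
rewrite [X in P X](_ : _ = \bigcap_(j in [set` (i |` I)%fset]) E' j).
  rewrite H; last first.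
    move=> j; rewrite in_fset1U => /orP[/eqP ->|jI]; first by rewrite E'i.
    by rewrite EE'//; have [] := IE _ jI.
  rewrite muleC; congr (_ * _)%E; rewrite indepF; last by move=> j /IE[].
  by apply: eq_big_seq => j jI; rewrite EE'.
rewrite set_fsetU1 bigcap_setU1 E'i setIC; congr (_ `&` _).
by apply: eq_bigcapr => j jI; rewrite EE'.
Qed.

Lemma sigma_rv_setI d' (T' : measurableType d') (X : T -> T') :
  setI_closed (sigma_rv X).
Proof.
move=> _ _ [A mA <-] [A' mA' <-]; exists (A `&` A'); first exact: measurableI.
by rewrite !setTI preimage_setI.
Qed.

Lemma sigma_rv_setT d' (T' : measurableType d') (X : T -> T') :
  sigma_rv X setT.
Proof. by exists setT => //; rewrite setTI preimage_setT. Qed.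

Lemma sigma_rv_measurable d' (T' : measurableType d') (X : {RV P >-> T'}) :
  sigma_rv X `<=` measurable.
Proof. by move=> _ [A mA <-]; exact: measurable_funP. Qed.

Lemma g_sigma_sub (G : set_system T) : G `<=` measurable -> <<s G >> `<=` measurable.
Proof.
move=> Gm; apply: smallest_sub => //.
by split; [exact: measurable0|move=> A mA; rewrite setTD; exact: measurableC|
  move=> F mF; exact: bigcup_measurable].
Qed.

Lemma g_sigma_setI (G : set_system T) : setI_closed <<s G >>.
Proof.
move=> A B GA GB.
exact: (@measurableI _ (g_sigma_algebraType G) A B).
Qed.

Lemma g_sigma_setT (G : set_system T) : <<s G >> setT.
Proof. exact: (@measurableT _ (g_sigma_algebraType G)). Qed.

Lemma sub_g_sigma (G : set_system T) : G `<=` <<s G >>.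
Proof. exact: sub_gen_smallest. Qed.

(** The pi-system that generates the join of two set systems. *)
Definition pairwise_setI (F G : set_system T) : set_system T :=
  [set C | exists A A', [/\ F A, G A' & C = A `&` A']].

Lemma pairwise_setI_closed (F G : set_system T) :
  setI_closed F -> setI_closed G -> setI_closed (pairwise_setI F G).
Proof.
move=> FI GI _ _ [A [A' [FA GA' ->]]] [C [C' [FC GC' ->]]].
by exists (A `&` C), (A' `&` C'); split; [exact: FI|exact: GI|rewrite setIACA].
Qed.

Lemma pairwise_setI_measurable (F G : set_system T) :
  F `<=` measurable -> G `<=` measurable -> pairwise_setI F G `<=` measurable.
Proof.
move=> Fm Gm _ [A [A' [FA GA' ->]]].
by apply: measurableI; [exact: Fm|exact: Gm].
Qed.

Lemma pairwise_setIl (F G : set_system T) : G setT -> F `<=` pairwise_setI F G.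
Proof. by move=> GT A FA; exists A, setT; rewrite setIT. Qed.

Lemma pairwise_setIr (F G : set_system T) : F setT -> G `<=` pairwise_setI F G.
Proof. by move=> FT A GA; exists setT, A; rewrite setTI. Qed.

End pi_systems.

Section layer_cake.
Context d (T : measurableType d) (R : realType) (P : probability T R).
Local Open Scope ereal_scope.

(** Layer cake formula: Tonelli's theorem applied to the subgraph of [g], whose
    sections [`[0, g w[] have length [g w]. *)
Lemma integral_layers (f g : T -> R) :
  measurable_fun setT f -> measurable_fun setT g ->
  (forall w, 0 <= f w)%R -> (forall w, 0 <= g w)%R ->
  \int[P]_w (f w * g w)%:E =
  \int[lebesgue_measure]_t \int[P]_w (f w * \1_(`[0%R, g w[) t)%:E.
Proof.
move=> mf mg f0 g0.
transitivity (\int[P]_w \int[lebesgue_measure]_t (f w * \1_(`[0%R, g w[) t)%:E).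
  apply: eq_integral => w _.
  under eq_integral do rewrite EFinM.
  rewrite ge0_integralZl//; last 2 first.
    by apply/measurable_EFinP/measurable_indic.
    by rewrite lee_fin.
  rewrite integral_indic// setIT EFinM; congr (_ * _).
  apply/esym; rewrite [LHS]lebesgue_measure_itv/= lte_fin.
  by case: ltgtP (g0 w) => // [_ _|<- _]; rewrite ?sube0.
rewrite (@fubini_tonelli _ _ _ _ _ P lebesgue_measure
  (fun p : T * measurableTypeR R => (f p.1 * \1_(`[0%R, g p.1[) p.2)%:E))//=.
  apply/measurable_EFinP/measurable_funM.
    by apply: measurableT_comp.
  have mA : measurable [set p : T * measurableTypeR R | p.2 \in `[0%R, g p.1[].
    rewrite (_ : [set _ | _] =
      (fun p : T * measurableTypeR R => (0 <= p.2)%R) @^-1` [set true] `&`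
      (fun p : T * measurableTypeR R => (p.2 < g p.1)%R) @^-1` [set true]).
      apply: measurableI; rewrite -[X in measurable X]setTI.
        by apply: measurable_fun_ler.
      by apply: measurable_fun_ltr => //; apply: measurableT_comp.
    by apply/seteqP; split => p /=; rewrite in_itv/= => /andP.
  rewrite (_ : (fun _ => _) = \1_[set p : T * measurableTypeR R |
     p.2 \in `[0%R, g p.1[]); first exact: measurable_indic.
  by apply/funext => p; rewrite !indicE; congr (_%:R); rewrite !inE.
by move=> p; rewrite lee_fin mulr_ge0.
Qed.

(** If the measure with density [f] is proportional to [P] on the level sets of
    [g], it integrates [g] proportionally as well. *)
Lemma integral_proportional (f g : T -> R) (c : R) :
  measurable_fun setT f -> measurable_fun setT g ->
  (forall w, 0 <= f w)%R -> (forall w, 0 <= g w)%R -> (0 <= c)%R ->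
  (forall t : R, \int[P]_(w in [set w | (t < g w)%R]) (f w)%:E =
     c%:E * P [set w | (t < g w)%R]) ->
  \int[P]_w (f w * g w)%:E = c%:E * \int[P]_w (g w)%:E.
Proof.
move=> mf mg f0 g0 c0 fg.
have layer (h : T -> R) (t : R) : measurable_fun setT h ->
    \int[P]_w (h w * \1_(`[0%R, g w[) t)%:E =
    (if (0 <= t)%R then \int[P]_(w in [set w | (t < g w)%R]) (h w)%:E else 0).
  move=> mh; case: leP => t0.
    rewrite [RHS]integral_mkcond; apply: eq_integral => w _.
    rewrite patchE indicE mem_setE in_itv/= t0/=.
    case: ifPn; rewrite ?inE/=; first by move=> ->; rewrite mulr1.
    by rewrite notin_setE/= => /negP/negbTE ->; rewrite mulr0.
  apply: integral0_eq => w _; rewrite indicE mem_setE in_itv/=.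
  by rewrite leNgt t0 mulr0.
rewrite integral_layers//.
transitivity (c%:E * \int[P]_w ((cst 1%R w : R) * g w)%:E); last first.
  by congr (_ * _); apply: eq_integral => w _; rewrite /= mul1r.
rewrite integral_layers//.
have mS (t : R) : measurable [set w | (t < g w)%R].
  rewrite (_ : [set _ | _] = g @^-1` `]t, +oo[).
    by rewrite -[X in measurable X]setTI; exact: mg.
  by apply/seteqP; split=> w /=; rewrite in_itv/= andbT.
have I1 (t : R) :
    \int[P]_(w in [set w | (t < g w)%R]) (cst 1%R w)%:E = P [set w | (t < g w)%R].
  by rewrite [LHS](@integral_cst _ _ _ P _ (mS t) 1) mul1e.
under eq_integral => t _.
  rewrite layer// fg (_ : (if _ then _ else _) =
    c%:E * (if (0 <= t)%R then \int[P]_(w in [set w | (t < g w)%R]) (cst 1%R w)%:E else 0)); last first.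
    by case: ifP => _; rewrite ?mule0// I1.
  rewrite -layer//.
  over.
rewrite ge0_integralZl//; last first.
  by move=> t _; apply: integral_ge0 => w _; rewrite lee_fin mulr_ge0.
under [X in measurable_fun _ X]eq_fun do rewrite layer//.
apply: measurable_fun_if => //.
- exact: measurable_fun_ler.
- apply: measurable_funTS.
  under eq_fun do rewrite I1.
  apply: (eq_measurable_fun (EFin \o (fun t : R => fine (P [set w | (t < g w)%R])))).
    by move=> t _ /=; rewrite fineK// fin_num_measure.
  apply/measurable_EFinP; apply: nonincreasing_measurable => // s t st.
  rewrite fine_le ?fin_num_measure// le_measure ?inE//.
  by move=> w /=; apply: le_lt_trans.
Qed.

End layer_cake.

(** * Independence structure of the model *)

Section model.
Context d (T : measurableType d) (R : realType) (P : probability T R).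
Variables (phi : int -> {RV P >-> R}) (B : int -> int -> {RV P >-> bool})
  (Z : int -> {RV P >-> nat}).
Hypothesis model : rcinar_model phi B Z.

Definition mean_survival : R := fine (\int[P]_w (phi 0 w)%:E).
Local Notation rho := mean_survival.

Let phi_ge0 n w : 0 <= phi n w.
Proof. by have /andP[] := phi_unit_interval model n w. Qed.

Let phi_le1 n w : phi n w <= 1.
Proof. by have /andP[] := phi_unit_interval model n w. Qed.

(** [y] is replaced by [`|y|] because the change of variables formula wants an
    integrand that is nonnegative on the whole line. *)
Lemma mean_survivalE n : (\int[P]_w (phi n w)%:E)%E = rho%:E.
Proof.
have fin m : (\int[P]_w (phi m w)%:E)%E \is a fin_num.
  rewrite ge0_fin_numE; last by apply: integral_ge0 => w _; rewrite lee_fin.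
  apply: (@le_lt_trans _ _ (\int[P]_w cst 1 w)%E).
    apply: ge0_le_integral => //; first by move=> w _; rewrite lee_fin.
    - exact/measurable_EFinP.
    - by move=> w _; rewrite lee_fin.
  by rewrite integral_cst// mul1e (le_lt_trans (probability_le1 P measurableT))// ltry.
rewrite /rho fineK//.
have distr m : (\int[P]_w (phi m w)%:E = \int[distribution P (phi m)]_y (`|y|)%:E)%E.
  rewrite ge0_integral_distribution//; last by apply/measurable_EFinP.
  by apply: eq_integral => w _; rewrite /= ger0_norm.
rewrite !distr; apply: eq_measure_integral => A mA _.
exact: (phi_iid model).2.
Qed.

Lemma mean_survival_ge0 : 0 <= rho.
Proof.
by rewrite fine_ge0// integral_ge0// => w _; rewrite lee_fin.
Qed.

(** If [E phi = 1], then [1 - phi >= 0] has mean [0] and vanishes almost surely. *)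
Lemma mean_survival_lt1 : (P [set w | (phi 0 w = 1)%R] < 1)%E -> rho < 1.
Proof.
move=> phi1; rewrite -lte_fin -(mean_survivalE 0) ltNge; apply/negP => ge1.
have m1phi : measurable_fun setT (fun w => (1 - phi 0 w)%:E).
  by apply/measurable_EFinP; apply: measurable_funB.
have int0 : (\int[P]_w (1 - phi 0 w)%:E = 0)%E.
  apply/eqP; rewrite eq_le; apply/andP; split; last first.
    by apply: integral_ge0 => w _; rewrite lee_fin subr_ge0.
  have : (\int[P]_w (1 - phi 0 w)%:E + \int[P]_w (phi 0 w)%:E = 1)%E.
    rewrite -ge0_integralD//; [|by move=> w _; rewrite lee_fin ?subr_ge0|by move=> w _; rewrite lee_fin|exact/measurable_EFinP].
    transitivity (\int[P]_w cst 1 w)%E.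
      by apply: eq_integral => w _; rewrite /= -EFinD subrK.
    by rewrite integral_cst// mul1e [LHS]probability_setT.
  rewrite mean_survivalE => /eqP; rewrite eq_sym -sube_eq//; last first.
    by rewrite fin_num_adde_defl.
  by move=> /eqP <-; rewrite sube_le0 -(mean_survivalE 0).
have /(ae_eq_integral_abs P measurableT m1phi) ae0 :
    (\int[P]_w `|(1 - phi 0 w)%:E| = 0)%E.
  rewrite -int0; apply: eq_integral => w _.
  by rewrite gee0_abs// lee_fin subr_ge0.
have : P.-negligible (~` [set w | phi 0 w = 1]).
  apply: negligibleS ae0 => w /= phi_neq1 /(_ I) [] /eqP.
  by rewrite subr_eq0 eq_sym => /eqP.
have m1 : measurable [set w | phi 0 w = 1].
  rewrite (_ : [set w | _] = phi 0 @^-1` [set 1])//.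
move=> /measure_negligible; move=> /(_ (measurableC m1)).
rewrite [X in X = _ -> _]probability_setC// => eq0.
by move: phi1; rewrite -sube_gt0 [X in (_ < X)%E]eq0 ltxx.
Qed.

Section survival_independence.
Variable n : int.

Let past_phi := <<s cylinders (fun j => sigma_rv (phi j)) [set j | j < n] >>.

Let past_phi_measurable : past_phi `<=` measurable.
Proof.
apply: g_sigma_sub; apply: cylinders_measurable => j.
exact: sigma_rv_measurable.
Qed.

Let past_phi_indep A (t : R) : past_phi A ->
  P (A `&` [set w | t < phi n w]) = (P A * P [set w | (t < phi n w)%R])%E.
Proof.
move=> pA.
have rvA : sigma_rv (phi n) [set w | t < phi n w].
  exists `]t, +oo[%classic => //; rewrite setTI; apply/seteqP.
  by split=> w /=; rewrite in_itv/= andbT.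
apply: (indep_g_sigma _ _ _ _ pA).
- by apply: cylinders_setI => i; [exact: sigma_rv_setI|exact: sigma_rv_setT].
- apply: cylinders_measurable => j; exact: sigma_rv_measurable.
- exact: sigma_rv_measurable rvA.
- move=> C cylC; have [indep _] := phi_iid model.
  by apply: (mutual_indep_cylinders indep _ rvA cylC) => /=; rewrite ltxx.
Qed.

(** The survival probability of a generation is independent of the earlier
    ones; both arguments of the product are integrated by levels. *)
Let survival_indep (g : T -> R) :
  (forall w, 0 <= g w) ->
  (forall t, past_phi [set w | t < g w]) ->
  (\int[P]_w (phi n w * g w)%:E = rho%:E * \int[P]_w (g w)%:E)%E.
Proof.
move=> g0 pastg.
have mg : measurable_fun setT g.
  apply: (measurability (@RGenOInfty.G R)).
    exact: RGenOInfty.measurableE.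
  move=> _ [_ [t ->] <-]; rewrite setTI.
  rewrite (_ : _ @^-1` _ = [set w | t < g w]).
    exact: past_phi_measurable.
  by apply/seteqP; split=> w /=; rewrite in_itv/= andbT.
apply: integral_proportional => // [|t]; first exact: mean_survival_ge0.
have mA := past_phi_measurable (pastg t).
set A := [set w | t < g w] in mA *.
transitivity (\int[P]_w (\1_A w * phi n w)%:E)%E.
  rewrite integral_mkcond; apply: eq_integral => w _.
  by rewrite patchE indicE; case: ifP => _; rewrite ?mul1r ?mul0r.
rewrite (@integral_proportional _ _ _ P _ _ (fine (P A)))//.
- by rewrite fineK ?fin_num_measure// mean_survivalE muleC.
- by rewrite fine_ge0.
- move=> s; rewrite fineK ?fin_num_measure// -past_phi_indep; last exact: pastg.
  by rewrite integral_indic// -[X in measurable X]setTI;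
    apply: (measurable_fun_ltr (f := cst s)).
Qed.

(** A coin generates only four events, so its conditional probabilities are
    [0], [1], [phi j] and [1 - phi j]. *)
Let coin_cond_prob j k (E : set T) : j < n -> sigma_rv (B j k) E ->
  exists g : T -> R, [/\ is_cond_prob P (sigma_family phi) E g,
    forall w, 0 <= g w &
    measurable_fun setT
      (g : g_sigma_algebraType (cylinders (fun j => sigma_rv (phi j)) [set j | j < n]) -> R)].
Proof.
move=> jn [Y _ <-]; rewrite setTI.
set G := cylinders _ _.
have mphi : measurable_fun setT (phi j : g_sigma_algebraType G -> R).
  move=> _ A mA; rewrite setTI; apply: sub_g_sigma.
  by apply: (@sub_cylinders _ _ _ _ _ j) => //; exists A => //; rewrite setTI.
have const (c : R) (C : set T) : (forall A, sigma_family phi A ->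
    (\int[P]_(w in A) c%:E = P (A `&` C))%E) ->
    is_cond_prob P (sigma_family phi) C (fun=> c).
  move=> cC; split => //.
  - move=> A _; have [Ac|nAc] := pselect (A c).
      by rewrite (_ : _ @^-1` _ = setT); [exact: g_sigma_setT|by apply/seteqP; split].
    rewrite (_ : _ @^-1` _ = set0); last by apply/seteqP; split=> w.
    exact: (@measurable0 _ (g_sigma_algebraType _)).
  - exact: finite_measure_integrable_cst.
have mfam : sigma_family phi `<=` measurable.
  by apply: g_sigma_sub => A [i _]; exact: sigma_rv_measurable.
have [Yt|Yt] := pselect (Y true); have [Yf|Yf] := pselect (Y false).
- exists (fun=> 1); split => //; apply: const => A /mfam mA.
  rewrite integral_cst// mul1e; congr (P _).
  by apply/seteqP; split=> [w Aw|w []//]; split => //=; case: (B j k w).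
- exists (phi j); split => //.
  rewrite (_ : _ @^-1` _ = [set w | B j k w = true]); first exact: (B_cond_prob1 model).
  by apply/seteqP; split=> w /=; case: (B j k w).
- exists (fun w => 1 - phi j w); split => //.
  + rewrite (_ : _ @^-1` _ = [set w | B j k w = false]); first exact: (B_cond_prob0 model).
    by apply/seteqP; split=> w /=; case: (B j k w).
  + by move=> w; rewrite subr_ge0.
  + exact: measurable_funB.
- exists (fun=> 0); split => //; apply: const => A /mfam mA.
  rewrite integral_cst// mul0e (_ : _ `&` _ = set0) ?measure0//.
  by apply/seteqP; split=> [w []|w //] /=; case: (B j k w).
Qed.

(** Given the environment, the coin of generation [n] and a cylinder of earlier
    coins are independent, with conditional probabilities [phi n] and a product of
    functions of the [phi j], [j < n]. These two are independent in turn, so the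
    product rule survives when the environment is averaged out. *)
Lemma coin_indep_cylinders k (A : set T) :
  cylinders (fun p : int * int => sigma_rv (B p.1 p.2)) [set p | p.1 < n] A ->
  P (A `&` [set w | B n k w = true]) = (P A * rho%:E)%E.
Proof.
move=> [I [E [IE ->]]].
have /choice[g Hg] : forall p, exists g : T -> R, p \in I ->
    [/\ is_cond_prob P (sigma_family phi) (E p) g, forall w, 0 <= g w &
    measurable_fun setT
      (g : g_sigma_algebraType (cylinders (fun j => sigma_rv (phi j)) [set j | j < n]) -> R)].
  move=> p; have [/IE[/= pn Ep]|] := boolP (p \in I).
    by have [g ?] := coin_cond_prob pn Ep; exists g.
  by exists (fun=> 0).
have nI : (n, k) \notin I by apply/negP => /IE[]/=; rewrite ltxx.
pose E' p := if p == (n, k) then [set w | B n k w = true] else E p.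
pose g' p := if p == (n, k) then (phi n : T -> R) else g p.
have E'n : E' (n, k) = [set w | B n k w = true] by rewrite /E' eqxx.
have g'n : g' (n, k) = phi n by rewrite /g' eqxx.
have E'I p : p \in I -> E' p = E p.
  by rewrite /E'; case: eqP => // -> pI; rewrite pI in nI.
have g'I p : p \in I -> g' p = g p.
  by rewrite /g'; case: eqP => // -> pI; rewrite pI in nI.
have TT : sigma_family phi setT by exact: g_sigma_setT.
have [_ _ /(_ _ TT)] := B_cond_indep model (I := I) (E := E) (g := g)
  (fun p pI => conj (IE p pI).2 (let: And3 x _ _ := Hg p pI in x)).
rewrite setTI => intI.
have [] := B_cond_indep model (I := ((n, k) |` I)%fset) (E := E') (g := g').
  move=> p; rewrite in_fset1U => /orP[/eqP ->|pI].
    rewrite E'n g'n; split; last exact: (B_cond_prob1 model).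
    exists [set true] => //; rewrite setTI; apply/seteqP; split=> w //=.
  by rewrite E'I// g'I//; split; [exact: (IE p pI).2|have [] := Hg p pI].
move=> _ _ /(_ _ TT); rewrite setTI => intI'.
rewrite -intI muleC (_ : _ `&` _ = \bigcap_(i in [set` ((n, k) |` I)%fset]) E' i); last first.
  rewrite set_fsetU1 bigcap_setU1 E'n setIC; congr (_ `&` _).
  by apply: eq_bigcapr => p pI; rewrite E'I.
rewrite -intI' -survival_indep.
- apply: eq_integral => w _; congr EFin; rewrite big_fsetU1//= g'n; congr (_ * _).
  by apply: eq_big_seq => p pI; rewrite g'I.
- move=> w; rewrite big_seq; apply: prodr_ge0 => p pI.
  by have [] := Hg p pI.
- move=> t; have : measurable_fun setT
    ((fun w => \prod_(i <- I) g i w) : g_sigma_algebraType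
       (cylinders (fun j => sigma_rv (phi j)) [set j | j < n]) -> R).
    by apply: measurable_prod => p pI; have [] := Hg p pI.
  move=> /(_ measurableT `]t, +oo[%classic) mg.
  have := mg (measurable_itv _); rewrite setTI /past_phi.
  rewrite (_ : _ @^-1` _ = [set w | t < \prod_(i <- I) g i w])//.
  by apply/seteqP; split=> w /=; rewrite in_itv/= andbT.
Qed.

End survival_independence.

End model.

Section chain_measurability.
Context d (T : measurableType d).

Lemma measurable_nat_select (x : T -> nat) (f : nat -> T -> nat) :
  measurable_fun setT x -> (forall m, measurable_fun setT (f m)) ->
  measurable_fun setT (fun w => f (x w) w).
Proof.
move=> mx mf _ A mA; rewrite setTI.
rewrite (_ : _ @^-1` _ = \bigcup_m (x @^-1` [set m] `&` f m @^-1` A)).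
  apply: bigcup_measurable => m _; apply: measurableI.
    by rewrite -[X in measurable X]setTI; apply: mx.
  by rewrite -[X in measurable X]setTI; apply: mf.
apply/seteqP; split=> [w /= fA|w /= [m _ [<-]]//].
by exists (x w).
Qed.

Lemma measurable_thinning (x : T -> nat) (b : nat -> T -> bool) :
  measurable_fun setT x -> (forall k, measurable_fun setT (b k)) ->
  measurable_fun setT (fun w => (\sum_(1 <= k < (x w).+1) b k w)%N).
Proof.
move=> mx mb.
apply: (@measurable_nat_select x (fun m w => (\sum_(1 <= k < m.+1) b k w)%N)) => //.
elim=> [|m IHm].
  by under eq_fun do rewrite big_geq//; exact: measurable_cst.
under eq_fun do rewrite big_nat_recr//=.
apply: (@measurable_nat_comp2 _ _ _ _ addn) => //.
exact: (measurableT_comp (f := nat_of_bool)).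
Qed.

Lemma measurable_thinned_chain (b : nat -> nat -> T -> bool) (z : nat -> T -> nat)
    (n : nat) :
  (forall j k, (0 < j <= n)%N -> measurable_fun setT (b j k)) ->
  (forall j, (0 < j <= n)%N -> measurable_fun setT (z j)) ->
  measurable_fun setT (fun w => thinned_chain (fun j k => b j k w) (z ^~ w) n).
Proof.
elim: n => [|n IH] mb mz; first exact: measurable_cst.
apply: (@measurable_nat_comp2 _ _ _ _ addn); last by apply: mz; rewrite ltnSn.
apply: measurable_thinning; last by move=> k; apply: mb; rewrite ltnSn.
by apply: IH => [j k|j] /andP[j0 jn]; [apply: mb|apply: mz]; rewrite j0 ltnW.
Qed.

End chain_measurability.

Section histories.
Context d (T : measurableType d) (R : realType) (P : probability T R).
Variables (phi : int -> {RV P >-> R}) (B : int -> int -> {RV P >-> bool})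
  (Z : int -> {RV P >-> nat}).
Hypothesis model : rcinar_model phi B Z.
Local Notation rho := (mean_survival phi).

Let coins (p : int * int) : set_system T := sigma_rv (B p.1 p.2).
Let environment : set_system T :=
  <<s sigma_family phi `|`
      sigma_family (fun nk : int * int => B nk.1 nk.2 : T -> bool) >>.

Let coins_environment p : coins p `<=` environment.
Proof.
by move=> A pA; apply: sub_g_sigma; right; apply: sub_g_sigma; exists p.
Qed.

Let family_measurable d' (T' : measurableType d') (K : Type)
  (X : K -> {RV P >-> T'}) : sigma_family X `<=` measurable.
Proof. by apply: g_sigma_sub => A [k _]; exact: sigma_rv_measurable. Qed.

Let environment_measurable : environment `<=` measurable.
Proof.
by apply: g_sigma_sub => A [] /family_measurable.
Qed.

(** A pi-system generating all that is decided by the coins before generation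
    [n] and by the immigrations of all times. *)
Definition history (n : int) : set_system T :=
  pairwise_setI (cylinders (fun p => sigma_rv (B p.1 p.2)) [set p : int * int | p.1 < n])
    (sigma_family Z).

(** A pi-system generating everything but the immigration of generation [n]. *)
Definition surroundings (n : int) : set_system T :=
  pairwise_setI environment (cylinders (fun j => sigma_rv (Z j)) [set j | j != n]).

Let cylinders_environment (D : set (int * int)) :
  cylinders (fun p => sigma_rv (B p.1 p.2)) D `<=` environment.
Proof.
move=> _ [I [E [IE ->]]].
apply: (@fin_bigcap_measurable _ (g_sigma_algebraType (sigma_family phi `|`
      sigma_family (fun nk : int * int => B nk.1 nk.2 : T -> bool)))) => // p pI.
by apply: (coins_environment (p := p)); exact: (IE p pI).2.
Qed.

Let family_Z_setT : sigma_family Z setT.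
Proof. exact: g_sigma_setT. Qed.

(** The coins and the environment are independent of the immigrations, so it is
    enough to know that a coin is independent of the earlier coins. *)
Lemma history_coin_indep (n k : int) (A : set T) : <<s history n >> A ->
  P (A `&` [set w | B n k w = true]) = (P A * rho%:E)%E.
Proof.
have coinP : P [set w | B n k w = true] = rho%:E.
  have famT : sigma_family phi setT by exact: g_sigma_setT.
  have [_ _ /(_ _ famT)] := B_cond_prob1 model n k.
  by rewrite setTI => <-; exact: (mean_survivalE model).
have coin_rv : coins (n, k) [set w | B n k w = true].
  by exists [set true] => //; rewrite setTI; apply/seteqP; split=> w.
move=> hA; rewrite -coinP; apply: (indep_g_sigma _ _ _ _ hA).
- apply: pairwise_setI_closed; last exact: g_sigma_setI.
  by apply: cylinders_setI => p; [exact: sigma_rv_setI|exact: sigma_rv_setT].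
- apply: pairwise_setI_measurable; last exact: family_measurable.
  by apply: cylinders_measurable => p; exact: sigma_rv_measurable.
- exact: sigma_rv_measurable coin_rv.
- move=> _ [C [C' [cylC ZC' ->]]].
  have envC := cylinders_environment cylC.
  rewrite setIAC (phiB_Z_indep model) //; last first.
    by apply: g_sigma_setI => //; exact: (coins_environment coin_rv).
  rewrite (coin_indep_cylinders model k cylC) coinP (phiB_Z_indep model)//.
  by rewrite muleAC.
Qed.

Lemma surroundings_immigration_indep (n : int) (Y : set nat) (A : set T) :
  <<s surroundings n >> A ->
  P (A `&` Z n @^-1` Y) = (P A * P (Z n @^-1` Y))%E.
Proof.
have ZY : sigma_rv (Z n) (Z n @^-1` Y) by exists Y => //; rewrite setTI.
have cylZ (D : set int) C : cylinders (fun j => sigma_rv (Z j)) D C -> sigma_family Z C.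
  move=> [I [E [IE ->]]].
  apply: (@fin_bigcap_measurable _ (g_sigma_algebraType
    (\bigcup_(i in [set: int]) sigma_rv (Z i)))) => // j jI.
  by apply: sub_g_sigma; exists j => //; exact: (IE j jI).2.
have famZY : sigma_family Z (Z n @^-1` Y).
  by apply: sub_g_sigma; exists n.
move=> sA; apply: (indep_g_sigma _ _ _ _ sA).
- apply: pairwise_setI_closed; first exact: g_sigma_setI.
  by apply: cylinders_setI => p; [exact: sigma_rv_setI|exact: sigma_rv_setT].
- apply: pairwise_setI_measurable; first exact: environment_measurable.
  by apply: cylinders_measurable => p; exact: sigma_rv_measurable.
- exact: sigma_rv_measurable ZY.
- move=> _ [C [C' [envC cylC' ->]]].
  have ZC' := cylZ _ _ cylC'.
  rewrite -setIA (phiB_Z_indep model) //; last exact: g_sigma_setI.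
  have [indepZ _] := Z_iid model.
  rewrite (mutual_indep_cylinders indepZ _ ZY cylC'); last by rewrite /= eqxx.
  by rewrite (phiB_Z_indep model)// muleA.
Qed.

Lemma immigration_max_prob (n : nat) (t : R) :
  P [set w | forall i, (0 < i <= n)%N -> (Z i%:Z w)%:R <= t] =
  (fine (P [set w | (Z 0 w)%:R <= t]%R) ^+ n)%:E.
Proof.
pose E i := [set w | (Z i w)%:R <= t].
have EZ i : sigma_rv (Z i) (E i).
  by exists [set m : nat | m%:R <= t] => //; rewrite setTI.
have PE i : P (E i) = P (E 0).
  by apply: ((Z_iid model).2 i 0 [set m : nat | m%:R <= t]).
elim: n => [|n IH].
  rewrite expr0 (_ : [set w | _] = setT) ?probability_setT//.
  by apply/seteqP; split=> // w _ i; case: i.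
rewrite (_ : [set w | _] = [set w | forall i, (0 < i <= n)%N -> (Z i%:Z w)%:R <= t]
   `&` E n.+1%:Z); last first.
  apply/seteqP; split=> [w Zt|w [Zt ZSt] i /andP[i0]].
    split=> [i /andP[i0 ni]|]; last by apply: Zt; rewrite ltnSn.
    by apply: Zt; rewrite i0 ltnW.
  rewrite leq_eqVlt => /orP[/eqP ->//|ni].
  by apply: Zt; rewrite i0.
rewrite (mutual_indep_cylinders (Z_iid model).1 (D := [set j | j <= n%:Z]) _ (EZ _)).
- rewrite IH PE -[P (E 0)]fineK ?fin_num_measure//; last exact: sigma_rv_measurable (EZ 0).
  by rewrite -EFinM -exprSr.
- by move=> /=; rewrite lez_nat ltnn.
- case: n {IH} => [|n].
    rewrite [X in cylinders _ _ X](_ : _ = setT); first exact: cylinders_setT.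
    by apply/seteqP; split=> // w _ i; case: i.
  exists [fset (i%:Z) | i in iota 1 n.+1]%fset, E; split.
    move=> j /imfsetP[i ii ->]; have : i \in iota 1 n.+1 by exact: ii.
    rewrite mem_iota => /andP[i0 ni]; split => //=.
  apply/seteqP; split=> [w Zt j /= /imfsetP[i ii ->]|w Zt i /andP[i0 ni]].
    have : i \in iota 1 n.+1 by exact: ii.
    by rewrite mem_iota => /andP[i0 ni]; apply: Zt; rewrite i0 -ltnS.
  apply: (Zt i%:Z) => /=; apply/imfsetP; exists i => //=.
  by change (i \in iota 1 n.+1); rewrite mem_iota i0 add1n ltnS.
Qed.

(** The process whose immigrations above [v] are discarded. It is bounded at each
    time, so that all its moments are finite even if [Z] has no mean. *)
Definition truncated_rcinar (v : R) (n : nat) (w : T) : nat :=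
  thinned_chain (fun j k => B j%:Z k%:Z w) (fun j => truncate v (Z j%:Z w)) n.

Lemma rcinarE n w :
  rcinar B Z n w = thinned_chain (fun j k => B j%:Z k%:Z w) (fun j => Z j%:Z w) n.
Proof. by elim: n => //= n ->. Qed.

Lemma truncated_rcinar_bound (v : R) n w : 0 <= v ->
  (truncated_rcinar v n w <= n * Num.truncn v)%N.
Proof.
move=> v0; apply: thinned_chain_bound => j.
by rewrite truncn_ge_nat// truncate_ler.
Qed.

Lemma truncated_rcinar_history v n (A : set nat) :
  <<s history n.+1%:Z >> (truncated_rcinar v n @^-1` A).
Proof.
suff : measurable_fun setT
    (truncated_rcinar v n : g_sigma_algebraType (history n.+1%:Z) -> nat).
  by move=> /(_ measurableT A); rewrite setTI; apply.
apply: (@measurable_thinned_chain _ (g_sigma_algebraType (history n.+1%:Z))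
  (fun j k => B j%:Z k%:Z) (fun j w => truncate v (Z j%:Z w))).
- move=> j k /andP[_ jn] _ Y mY; apply: sub_g_sigma; rewrite setTI.
  apply: pairwise_setIl; first exact: family_Z_setT.
  apply: (@sub_cylinders _ _ _ _ _ (j%:Z, k%:Z)) => /=; first by rewrite ltz_nat.
  by exists Y; rewrite ?setTI.
- move=> j _; apply: (measurableT_comp (f := truncate v)) => // _ Y mY.
  apply: sub_g_sigma; rewrite setTI.
  apply: pairwise_setIr; first exact: cylinders_setT.
  by apply: sub_g_sigma; exists j%:Z => //; exists Y; rewrite ?setTI.
Qed.

Lemma truncated_rcinar_surroundings v n (A : set nat) :
  <<s surroundings n.+1%:Z >> (truncated_rcinar v n @^-1` A).
Proof.
suff : measurable_fun setT
    (truncated_rcinar v n : g_sigma_algebraType (surroundings n.+1%:Z) -> nat).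
  by move=> /(_ measurableT A); rewrite setTI; apply.
apply: (@measurable_thinned_chain _ (g_sigma_algebraType (surroundings n.+1%:Z))
  (fun j k => B j%:Z k%:Z) (fun j w => truncate v (Z j%:Z w))).
- move=> j k _ _ Y mY; apply: sub_g_sigma; rewrite setTI.
  apply: pairwise_setIl; first exact: cylinders_setT.
  apply: (@coins_environment (j%:Z, k%:Z)).
  by exists Y; rewrite ?setTI.
- move=> j /andP[_ jn]; apply: (measurableT_comp (f := truncate v)) => // _ Y mY.
  apply: sub_g_sigma; rewrite setTI.
  apply: pairwise_setIr; first exact: g_sigma_setT.
  apply: (@sub_cylinders _ _ _ _ _ j%:Z) => /=.
    by rewrite eqz_nat neq_ltn ltnS jn.
  by exists Y; rewrite ?setTI.
Qed.

Lemma measurable_truncated_rcinar v n : measurable_fun setT (truncated_rcinar v n).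
Proof.
apply: (@measurable_thinned_chain _ _
  (fun j k => B j%:Z k%:Z) (fun j w => truncate v (Z j%:Z w))) => // j _.
exact: (measurableT_comp (f := truncate v)).
Qed.

Lemma measurable_truncated_rcinar_preimage v n (A : set nat) :
  measurable (truncated_rcinar v n @^-1` A).
Proof.
rewrite -[X in measurable X]setTI.
exact: (measurable_truncated_rcinar v n).
Qed.

End histories.

(** * Moments of the truncated process *)

(** A substitute for Minkowski's inequality that stays linear in the [p]-th
    moments: either [b <= e * a], or [a <= b / e]. *)
Lemma exprDn_le_split (R : realFieldType) (p : nat) (e a b : R) :
  0 < e -> 0 <= a -> 0 <= b ->
  (a + b) ^+ p <= (1 + e) ^+ p * a ^+ p + (1 + e^-1) ^+ p * b ^+ p.
Proof.
move=> e0 a0 b0.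
have ie0 : 0 <= e^-1 by rewrite invr_ge0 ltW.
rewrite -!exprMn; have [ba|ab] := leP b (e * a).
  apply: (@le_trans _ _ (((1 + e) * a) ^+ p)).
    by apply: lerXn2r; rewrite ?nnegrE; nra.
  by rewrite lerDl exprn_ge0// mulr_ge0// addr_ge0.
apply: (@le_trans _ _ (((1 + e^-1) * b) ^+ p)).
  apply: lerXn2r; rewrite ?nnegrE; first by rewrite addr_ge0.
    by rewrite mulr_ge0// addr_ge0.
  rewrite mulrDl mul1r addrC lerD2l mulrC ler_pdivlMr// mulrC.
  exact: ltW.
by rewrite lerDr exprn_ge0// mulr_ge0// addr_ge0// ltW.
Qed.

Lemma exprn_perturb_lt1 (R : realType) (p : nat) (r : R) : 0 <= r -> r < 1 ->
  exists2 e : R, 0 < e & (1 + e) ^+ p * r < 1.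
Proof.
move=> r0 r1.
have cvg1 : (1 + e) ^+ p * r @[e --> (0:R)^'+] --> (1 + 0) ^+ p * r.
  apply: cvgMl; apply: (@cvg_comp _ _ _ (fun e => 1 + e) (fun x => x ^+ p)).
    by apply: cvgD; [exact: cvg_cst|apply: cvg_at_right_filter; exact: cvg_id].
  exact: exprn_continuous.
have lt1 : (1 + 0) ^+ p * r < 1 by rewrite addr0 expr1n mul1r.
near (0:R)^'+ => e; exists e; first by near: e; exact: nbhs_right_gt.
by near: e; exact: (cvgr_lt _ cvg1).
Unshelve. all: by end_near. Qed.

Section moments.
Context d (T : measurableType d) (R : realType) (P : probability T R).
Variables (phi : int -> {RV P >-> R}) (B : int -> int -> {RV P >-> bool})
  (Z : int -> {RV P >-> nat}).
Hypothesis model : rcinar_model phi B Z.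
Local Notation rho := (mean_survival phi).
Local Notation Xv := (truncated_rcinar B Z).
Variable q : nat.

Let mX v n := measurable_truncated_rcinar B Z v n.

Definition truncated_moment (v : R) : \bar R :=
  (\int[P]_w ((truncate v (Z 0 w))%:R ^+ q.+1)%:E)%E.

Lemma truncated_momentE v n :
  (\int[P]_w ((truncate v (Z n w))%:R ^+ q.+1)%:E)%E = truncated_moment v.
Proof.
have distr m : (\int[P]_w ((truncate v (Z m w))%:R ^+ q.+1)%:E =
    \int[distribution P (Z m)]_y ((truncate v y)%:R ^+ q.+1)%:E)%E.
  by rewrite ge0_integral_distribution// => y; rewrite lee_fin exprn_ge0.
rewrite /truncated_moment !distr; apply: eq_measure_integral => A mA _.
exact: (Z_iid model).2.
Qed.

Lemma measurable_truncated_power (v : R) n :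
  measurable_fun setT (fun w => (truncate v (Z n w))%:R ^+ q.+1 : R).
Proof.
by apply: (measurableT_comp (f := fun m : nat => (truncate v m)%:R ^+ q.+1 : R)).
Qed.

Lemma truncated_moment_ge0 v : (0 <= truncated_moment v)%E.
Proof. by apply: integral_ge0 => w _; rewrite lee_fin exprn_ge0. Qed.

Lemma truncated_moment_le v : 0 <= v -> (truncated_moment v <= (v ^+ q.+1)%:E)%E.
Proof.
move=> v0; apply: (@le_trans _ _ (\int[P]_w cst (v ^+ q.+1)%:E w)%E).
  apply: ge0_le_integral => //.
  - apply/measurable_EFinP; exact: measurable_truncated_power.
  - by move=> w _; rewrite lee_fin lerXn2r ?nnegrE// truncate_ler.
by rewrite integral_cst//= [P setT]probability_setT mule1.
Qed.

Lemma truncated_moment_fin v : 0 <= v -> truncated_moment v \is a fin_num.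
Proof.
move=> v0; rewrite ge0_fin_numE ?truncated_moment_ge0//.
exact: le_lt_trans (truncated_moment_le v0) (ltry _).
Qed.

(** Doubling the truncation level adds the values in [`]v, 2 * v]]. *)
Lemma truncated_moment_double v : 0 <= v ->
  fine (truncated_moment (2 * v)) <= fine (truncated_moment v) +
    (2 * v) ^+ q.+1 * fine (P [set w | v < (Z 0 w)%:R]).
Proof.
move=> v0; have v20 : 0 <= 2 * v by rewrite mulr_ge0.
have mA : measurable [set w | v < (Z 0 w)%:R].
  exact: (measurable_funPTI (Z 0) (Y := [set m | v < m%:R])).
have iA : (P [set w | (v < (Z 0 w)%:R)%R] = \int[P]_w (\1_[set w | v < (Z 0 w)%:R] w)%:E)%E.
  by rewrite integral_indic// setIT.
rewrite -lee_fin EFinD EFinM !fineK ?truncated_moment_fin ?fin_num_measure//.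
rewrite iA -ge0_integralZl_EFin//; last 2 first.
  by apply/measurable_EFinP/measurable_indic.
  by rewrite exprn_ge0.
rewrite -ge0_integralD//; last 3 first.
  by apply/measurable_EFinP; exact: measurable_truncated_power.
  by move=> w _; rewrite -EFinM lee_fin mulr_ge0// exprn_ge0.
  by apply: measurable_funeM; exact/measurable_EFinP/measurable_indic.
apply: ge0_le_integral => //.
- by apply/measurable_EFinP; exact: measurable_truncated_power.
- apply: emeasurable_funD; first by apply/measurable_EFinP; exact: measurable_truncated_power.
  by apply: measurable_funeM; exact/measurable_EFinP/measurable_indic.
- move=> w _; rewrite -EFinM -EFinD lee_fin indicE.
  have [zv|vz] := leP (Z 0 w)%:R v.
    rewrite /truncate zv (le_trans zv) ?lerDl; first by rewrite mulr_ge0// exprn_ge0.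
    by rewrite ler_peMl// ler1n.
  rewrite mem_set// mulr1 ler_wpDl ?exprn_ge0// lerXn2r ?nnegrE// truncate_ler//.
Qed.

(** The number of individuals is decided before the coins of the next generation
    are tossed. *)
Lemma coin_times_history v n k (f : nat -> R) : (forall m, 0 <= f m) ->
  (\int[P]_w ((B n.+1%:Z k w : nat)%:R * f (Xv v n w))%:E =
   rho%:E * \int[P]_w (f (Xv v n w))%:E)%E.
Proof.
move=> f0.
have mnat (g : nat -> R) (h : T -> nat) : measurable_fun setT h ->
    measurable_fun setT (fun w => g (h w)).
  by move=> mh; apply: (measurableT_comp (f := g)).
apply: integral_proportional => //.
- apply: mnat; apply: (measurableT_comp (f := nat_of_bool)) => //.
- exact: mnat (mX _ _).
- exact: (mean_survival_ge0 model).
- move=> t.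
  have hA : <<s history B Z n.+1%:Z >> [set w | t < f (Xv v n w)].
    exact: (@truncated_rcinar_history _ _ _ _ B Z v n [set m | t < f m]).
  have mA : measurable [set w | t < f (Xv v n w)].
    exact: (@measurable_truncated_rcinar_preimage _ _ _ _ B Z v n [set m | t < f m]).
  have mB : measurable [set w | B n.+1%:Z k w = true].
    exact: (measurable_funPTI (B n.+1%:Z k) (Y := [set true])).
  rewrite muleC -(history_coin_indep model k hA) setIC -integral_indic//.
  apply: eq_integral => w _; rewrite indicE; congr ((nat_of_bool _)%:R%:E).
  by apply/idP/idP => [Bt|]; [exact: mem_set|rewrite inE].
Qed.

(** As [S <= x] for a thinning [S] of [x] individuals, [S ^+ q.+1 <= x ^+ q * S],
    which is linear in the coins. *)
Lemma thinning_moment v n : 0 <= v ->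
  (\int[P]_w ((\sum_(1 <= k < (Xv v n w).+1) B n.+1%:Z k%:Z w)%N%:R ^+ q.+1)%:E <=
   rho%:E * \int[P]_w ((Xv v n w)%:R ^+ q.+1)%:E)%E.
Proof.
move=> v0; set N := (n * Num.truncn v)%N.
have mnat (g : nat -> R) (h : T -> nat) : measurable_fun setT h ->
    measurable_fun setT (fun w => (g (h w))%:E).
  by move=> mh; apply/measurable_EFinP; apply: (measurableT_comp (f := g)).
pose f k (m : nat) : R := (k <= m)%N%:R * m%:R ^+ q.
have f0 k m : 0 <= f k m by rewrite mulr_ge0// exprn_ge0.
have sum_f w : \sum_(1 <= k < N.+1) f k (Xv v n w) = (Xv v n w)%:R ^+ q.+1.
  rewrite /f -mulr_suml exprS; congr (_ * _).
  rewrite (@big_cat_nat _ _ _ (Xv v n w).+1)//=; last by rewrite ltnS truncated_rcinar_bound.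
  rewrite [X in _ + X]big_nat_cond [X in _ + X]big1 ?addr0; last first.
    by move=> k /andP[/andP[kX _] _]; rewrite leqNgt kX.
  rewrite big_nat_cond (eq_bigr (fun=> 1%:R)); last first.
    by move=> k /andP[/andP[_]]; rewrite ltnS => ->.
  by rewrite -big_nat_cond -natr_sum sum_nat_const_nat subn1 muln1.
have mBf k : measurable_fun setT (fun w => ((B n.+1%:Z k w : nat)%:R * f `|k|%N (Xv v n w))%:E).
  apply/measurable_EFinP; apply: measurable_funM; last first.
    by apply: (measurableT_comp (f := f `|k|%N)) => //; exact: mX.
  apply: (measurableT_comp (f := fun m : nat => m%:R : R)) => //.
  by apply: (measurableT_comp (f := nat_of_bool)).
apply: (@le_trans _ _ (\int[P]_w (\sum_(1 <= k < N.+1)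
    (((B n.+1%:Z k%:Z w : nat)%:R * f k (Xv v n w))%:E)))%E).
  apply: ge0_le_integral => //.
  - apply: (mnat (fun m => m%:R ^+ q.+1)).
    by apply: measurable_thinning.
  - by apply: emeasurable_sum => k; exact: (mBf k%:Z).
  - move=> w _; rewrite sumEFin lee_fin.
    apply: (@le_trans _ _ ((Xv v n w)%:R ^+ q * (\sum_(1 <= k < (Xv v n w).+1) B n.+1%:Z k%:Z w)%N%:R)).
      rewrite exprSr ler_wpM2r// lerXn2r ?nnegrE// ler_nat.
      exact: (thinning_le (fun j k => B j%:Z k%:Z w)).
    rewrite (@big_cat_nat _ _ _ (Xv v n w).+1 _ N.+1)//=; last first.
      by rewrite ltnS truncated_rcinar_bound.
    rewrite ler_wpDr ?sumr_ge0//; first by move=> k _; rewrite mulr_ge0.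
    rewrite natr_sum mulr_sumr; apply: ler_sum_nat => k /andP[_].
    by rewrite ltnS => kX; rewrite /f kX mul1r mulrC.
rewrite ge0_integral_sum//; last by move=> k w _; rewrite lee_fin mulr_ge0.
rewrite le_eqVlt; apply/orP; left; apply/eqP.
under eq_bigr do rewrite coin_times_history//.
rewrite -ge0_sume_distrr; last first.
  by move=> k _; apply: integral_ge0 => w _; rewrite lee_fin.
rewrite -ge0_integral_sum//; [|by move=> k; apply: (mnat (f k)); exact: mX|
  by move=> k w _; rewrite lee_fin].
by congr (_ * _)%E; apply: eq_integral => w _; rewrite sumEFin sum_f.
Qed.

Hypothesis rho_lt1 : rho < 1.

(** The contraction factor [rho < 1] beats the loss in the convexity inequality,
    so the moments stay within a constant multiple of those of one immigration,
    uniformly in time and in the truncation level. *)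
Lemma truncated_rcinar_moment : exists2 K : R, 0 <= K &
  forall (v : R) n, 0 <= v ->
    (\int[P]_w ((Xv v n w)%:R ^+ q.+1)%:E <= K%:E * truncated_moment v)%E.
Proof.
have rho0 := mean_survival_ge0 model.
have [e e0 re] := exprn_perturb_lt1 q.+1 rho0 rho_lt1.
set c := (1 + e^-1) ^+ q.+1.
have c0 : 0 <= c by rewrite exprn_ge0// addr_ge0// invr_ge0 ltW.
set r := (1 + e) ^+ q.+1 in re.
have r0 : 0 <= r by rewrite exprn_ge0// addr_ge0// ltW.
have K0 : 0 <= c / (1 - r * rho) by rewrite divr_ge0// subr_ge0 ltW.
exists (c / (1 - r * rho)) => // v n v0.
have G0 := truncated_moment_ge0 v.
elim: n => [|n IH].
  rewrite (eq_integral (cst 0%E)) => [|w _]; last by rewrite /= expr0n.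
  by rewrite integral0 mule_ge0.
set S := fun w => (\sum_(1 <= k < (Xv v n w).+1) B n.+1%:Z k%:Z w)%N.
have mS : measurable_fun setT (fun w => (S w)%:R ^+ q.+1 : R).
  apply: (measurableT_comp (f := fun m : nat => m%:R ^+ q.+1 : R)) => //.
  by apply: measurable_thinning.
have mZ := measurable_truncated_power v n.+1%:Z.
apply: (@le_trans _ _ (\int[P]_w (r%:E * ((S w)%:R ^+ q.+1)%:E +
    c%:E * ((truncate v (Z n.+1%:Z w))%:R ^+ q.+1)%:E))%E).
  apply: ge0_le_integral => //.
  - apply/measurable_EFinP.
    by apply: (measurableT_comp (f := fun m : nat => m%:R ^+ q.+1 : R)).
  - by apply: emeasurable_funD; apply: measurable_funeM; exact/measurable_EFinP.
  - move=> w _; rewrite -!EFinM -EFinD lee_fin.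
    rewrite [X in X%:R ^+ _](_ : _ = (S w + truncate v (Z n.+1%:Z w))%N)// natrD.
    exact: exprDn_le_split.
rewrite ge0_integralD//; last 4 first.
  by move=> w _; rewrite mule_ge0// lee_fin exprn_ge0.
  by apply: measurable_funeM; exact/measurable_EFinP.
  by move=> w _; rewrite mule_ge0// lee_fin exprn_ge0.
  by apply: measurable_funeM; exact/measurable_EFinP.
rewrite !ge0_integralZl_EFin//; [|exact/measurable_EFinP..].
rewrite truncated_momentE.
have {}IH := le_trans (thinning_moment n v0) (lee_wpmul2l _ IH).
apply: le_trans.
  apply: leeD; last exact: lexx.
  by apply: lee_wpmul2l; [rewrite lee_fin|apply: IH; rewrite lee_fin].
rewrite !muleA -!EFinM -ge0_muleDl ?lee_fin ?(mulr_ge0 (mulr_ge0 r0 rho0))//.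
apply: lee_wpmul2r => //; rewrite -EFinD lee_fin le_eqVlt; apply/orP; left.
have nz : 1 - r * rho != 0 by rewrite subr_eq0 eq_sym lt_eqF.
by apply/eqP; field.
Qed.

Lemma truncated_rcinar_tail : exists2 K : R, 0 <= K &
  forall (v a : R) n, 0 <= v -> 0 < a ->
    fine (P [set w | a < (Xv v n w)%:R]) <=
    K * fine (truncated_moment v) / a ^+ q.+1.
Proof.
have [K K0 momX] := truncated_rcinar_moment; exists K => // v a n v0 a0.
have mA : measurable [set w | a < (Xv v n w)%:R].
  exact: (@measurable_truncated_rcinar_preimage _ _ _ _ B Z v n [set m | a < m%:R]).
rewrite ler_pdivlMr ?exprn_gt0// -lee_fin EFinM fineK ?fin_num_measure//.
rewrite EFinM fineK ?truncated_moment_fin//; apply: le_trans (momX v n v0).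
have iA : (P [set w | (a < (Xv v n w)%:R)%R] = \int[P]_w (\1_[set w | a < (Xv v n w)%:R] w)%:E)%E.
  by rewrite integral_indic// setIT.
rewrite muleC iA -ge0_integralZl_EFin//; last 2 first.
  by apply/measurable_EFinP/measurable_indic.
  by rewrite exprn_ge0// ltW.
apply: ge0_le_integral => //.
- by move=> w _; rewrite -EFinM lee_fin mulr_ge0// exprn_ge0// ltW.
- by apply: measurable_funeM; exact/measurable_EFinP/measurable_indic.
- apply/measurable_EFinP.
  by apply: (measurableT_comp (f := fun m : nat => m%:R ^+ q.+1 : R)).
- move=> w _; rewrite -EFinM lee_fin indicE.
  have [|_] := boolP (w \in _); last by rewrite mulr0 exprn_ge0.
  by rewrite inE/= mulr1 => aX; rewrite lerXn2r ?nnegrE// ltW.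
Qed.

End moments.

(** * Regularly varying tails *)

Lemma cvg_powR_base (R : realType) (s c : R) : 0 < c ->
  (fun a : R => a `^ s) @ c --> c `^ s.
Proof.
move=> c0; have : derivable (fun a : R => a `^ s) c 1.
  by apply: derivable_powR; rewrite in_itv/= c0.
by move=> /derivable1_diffP/differentiable_continuous.
Qed.

(** From [expR (- y / (1 - y)) <= 1 - y <= expR (- y)] for [y < 1]. *)
Lemma cvg_exp_limit (R : realType) (x : nat -> R) (l : R) :
  (forall n, 0 <= x n) -> x n @[n --> \oo] --> 0 ->
  n%:R * x n @[n --> \oo] --> l ->
  (1 - x n) ^+ n @[n --> \oo] --> expR (- l).
Proof.
move=> x0 cx cnx.
apply: (@squeeze_cvgr _ _ _ _ (fun n => expR (- (n%:R * x n) / (1 - x n)))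
  (fun n => expR (- (n%:R * x n)))).
- near=> n.
  have x1 : x n < 1 by near: n; exact: (cvgr_lt _ cx).
  have d0 : 0 < 1 - x n by rewrite subr_gt0.
  have expn (y : R) : expR (n%:R * y) = expR y ^+ n by rewrite mulrC expRM_natr.
  have -> : - (n%:R * x n) / (1 - x n) = n%:R * - (x n / (1 - x n)).
    by rewrite mulNr -mulrA mulrN.
  rewrite -[- (n%:R * x n)]mulrN !expn; apply/andP; split.
    apply: lerXn2r; rewrite ?nnegrE ?expR_ge0 ?(ltW d0)//.
    rewrite expRN -[leRHS]invrK lef_pV2 ?posrE ?expR_gt0 ?invr_gt0//.
    apply: le_trans (expR_ge1Dx _).
    by rewrite le_eqVlt; apply/orP; left; apply/eqP; field; rewrite gt_eqF.
  apply: lerXn2r; rewrite ?nnegrE ?expR_ge0 ?(ltW d0)//.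
  exact: (le_trans _ (expR_ge1Dx _)).
- apply: (@cvg_comp _ _ _ (fun n => - (n%:R * x n) / (1 - x n)) expR); last exact: continuous_expR.
  have -> : - l = - l / (1 - 0) by rewrite subr0 divr1.
  apply: cvgM; first exact: cvgN.
  apply: cvgV; first by rewrite subr0 oner_neq0.
  by apply: cvgB => //; exact: cvg_cst.
- apply: (@cvg_comp _ _ _ (fun n => - (n%:R * x n)) expR); last exact: continuous_expR.
  exact: cvgN.
Unshelve. all: by end_near. Qed.

Section tails.
Variables (R : realType) (F h : R -> R) (alpha : R).
Hypothesis F_ge0 : forall t, 0 <= F t.
Hypothesis F_noninc : forall s t, s <= t -> F t <= F s.
Hypothesis F_cvg0 : F t @[t --> +oo] --> 0.
Hypothesis h_rv : regularly_varying alpha h.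
Hypothesis h_tail : h t * F t @[t --> +oo] --> (1 : R).

Let hF_gt0 : \forall t \near +oo, 0 < h t * F t.
Proof. by apply: (cvgr_gt _ h_tail); exact: ltr01. Qed.

Lemma tail_gt0 t : 0 < F t.
Proof.
near (+oo : set_system R) => s.
have hFs : 0 < h s * F s by near: s; exact: hF_gt0.
have ts : t <= s by near: s; exact: (nbhs_pinfty_ge (num_real _)).
apply: lt_le_trans (F_noninc ts); rewrite lt_def F_ge0 andbT.
by apply/eqP => Fs; rewrite Fs mulr0 ltxx in hFs.
Unshelve. all: by end_near. Qed.

Let h_gt0 : \forall t \near +oo, 0 < h t.
Proof.
near=> t; have : 0 < h t * F t by near: t; exact: hF_gt0.
by rewrite pmulr_lgt0// tail_gt0.
Unshelve. all: by end_near. Qed.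

Let scale_cvgy (c : R) : 0 < c -> c * t @[t --> +oo] --> +oo.
Proof. by move=> c0; apply: gt0_cvgMry => //; exact: cvg_id. Qed.

(** The tail inherits the regular variation of [h], with index [- alpha]. *)
Lemma tail_scaled (c : R) : 0 < c ->
  h t * F (c * t) @[t --> +oo] --> c `^ (- alpha).
Proof.
move=> c0; have [L [hL cL]] := h_rv.
have cinv : (L (c * t) / L t)^-1 @[t --> +oo] --> (1 : R)^-1.
  by apply: cvgV; [exact: oner_neq0|exact: cL].
have chF : h (c * t) * F (c * t) @[t --> +oo] --> (1 : R).
  by apply: (@cvg_comp _ _ _ (fun t => c * t) (fun t => h t * F t));
    [exact: scale_cvgy|exact: h_tail].
have : c `^ (- alpha) * (h (c * t) * F (c * t) * (L (c * t) / L t)^-1)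
    @[t --> +oo] --> c `^ (- alpha) * (1 * 1^-1).
  by apply: cvgMr; exact: cvgM.
rewrite invr1 !mulr1; apply: cvg_trans; apply: near_eq_cvg; near=> t.
have t0 : 0 < t by near: t; exact: (nbhs_pinfty_gt (num_real _)).
have ht0 : 0 < h t by near: t; exact: h_gt0.
have hct0 : 0 < h (c * t) by near: t; exact: (scale_cvgy c0 h_gt0).
have ct0 : 0 < c * t by rewrite mulr_gt0.
have pt : 0 < t `^ alpha by rewrite powR_gt0.
have pc : 0 < c `^ alpha by rewrite powR_gt0.
have Lt : L t != 0.
  by apply/eqP => Lt; move: ht0; rewrite hL// Lt mulr0 ltxx.
have Lct : L (c * t) != 0.
  by apply/eqP => Lct; move: hct0; rewrite hL// Lct mulr0 ltxx.
rewrite /= powRN (hL _ ct0) (hL _ t0) powRM ?ltW//.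
by field; rewrite Lt Lct !gt_eqF.
Unshelve. all: by end_near. Qed.

Lemma h_cvgy : h t @[t --> +oo] --> +oo.
Proof.
apply/cvgryPge => A; near=> t.
have hF : 2^-1 < h t * F t.
  by near: t; apply: (cvgr_gt _ h_tail); rewrite invf_lt1// ltr1n.
have FA : F t < (2 * (`|A| + 1))^-1.
  near: t; apply: (cvgr_lt _ F_cvg0).
  by rewrite invr_gt0 mulr_gt0// ltr_wpDl.
have A1 : 0 < `|A| + 1 by rewrite ltr_wpDl.
have ht : 0 < h t by near: t; exact: h_gt0.
have : 2^-1 < h t * (2 * (`|A| + 1))^-1 by apply: (lt_trans hF); rewrite ltr_pM2l.
rewrite invfM mulrA [h t / 2]mulrC -mulrA -[X in X < _]mulr1 ltr_pM2l ?invr_gt0//.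
rewrite ltr_pdivlMr// mul1r => Ah.
by apply: le_trans (ltW Ah); apply: le_trans (ler_norm _) _; rewrite lerDl.
Unshelve. all: by end_near. Qed.

Hypothesis h_bounded : exists C, forall t, 0 < t -> h t * F t <= C.

Local Notation b := (norming h).
Let level n := [set t : R | 0 < t /\ n%:R <= h t].

Let level_neq0 n : level n !=set0.
Proof.
near (+oo : set_system R) => t; exists t; split.
  by near: t; exact: (nbhs_pinfty_gt (num_real _)).
by near: t; move/cvgryPge : h_cvgy; apply.
Unshelve. all: by end_near. Qed.

Let level_lb n : lbound (level n) 0.
Proof. by move=> t [/ltW]. Qed.

(** Boundedness of [h * F] makes [h] bounded on bounded intervals, so that large
    levels are only reached far away. *)
Lemma norming_cvgy : b n @[n --> \oo] --> +oo.
Proof.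
have [C hC] := h_bounded.
apply/cvgryPge => A; near=> n.
apply: lb_le_inf; first exact: level_neq0.
move=> t [t0 nh]; rewrite leNgt; apply/negP => tA.
have Ft : F A <= F t by apply: F_noninc; exact: ltW.
have FA := tail_gt0 A.
have : n%:R <= C / F A.
  rewrite ler_pdivlMr//; apply: le_trans (hC t t0).
  by apply: ler_pM => //; exact: ltW.
apply/negP; rewrite -ltNge; near: n; exact: nbhs_infty_gtr.
Unshelve. all: by end_near. Qed.

Let cvg_norming_scaled (c : R) : 0 < c -> c * b n @[n --> \oo] --> +oo.
Proof.
by move=> c0; apply: (@cvg_comp _ _ _ (fun n => b n) (fun t => c * t));
  [exact: norming_cvgy|exact: scale_cvgy].
Qed.

(** [h] need not be monotone, so [h (b n)] may be far from [n]. But [h] reaches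
    [n] somewhere in [`[b n, z1 * b n[] and stays below [n] at [z2 * b n], for any
    [z2 < 1 < z1], and the monotonicity of [F] transfers these bounds to
    [F (y * b n)]. *)
Lemma norming_tail (y : R) : 0 < y ->
  n%:R * F (y * b n) @[n --> \oo] --> y `^ (- alpha).
Proof.
move=> y0; apply/cvgrPdist_le => e e0.
pose g z := (y / z) `^ (- alpha).
have g1 : g z @[z --> (1:R)] --> y `^ (- alpha).
  have -> : y `^ (- alpha) = (y / 1) `^ (- alpha) by rewrite divr1.
  apply: (@cvg_comp _ _ _ (fun z => y / z) (fun a => a `^ (- alpha))).
    by apply: cvgMr; apply: cvgV; [exact: oner_neq0|exact: cvg_id].
  by apply: cvg_powR_base; rewrite divr1.
have e20 : 0 < e / 2 by rewrite divr_gt0.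
have [z1 z1_gt1 g_z1] : exists2 z : R, 1 < z & g z < y `^ (- alpha) + e / 2.
  near (1:R)^'+ => z; exists z; first by near: z; exact: nbhs_right_gt.
  by near: z; apply: (cvgr_lt _ (cvg_at_right_filter g1)); rewrite ltrDl.
have [z2 z2_lt1 g_z2] : exists2 z : R, 0 < z < 1 & y `^ (- alpha) - e / 2 < g z.
  near (1:R)^'- => z; exists z.
    by apply/andP; split; near: z; [exact: nbhs_left_gt|exact: nbhs_left_lt].
  by near: z; apply: (cvgr_gt _ (cvg_at_left_filter g1)); rewrite gtrBl.
have [z2_gt0 {}z2_lt1] := andP z2_lt1.
have z1_gt0 : 0 < z1 by apply: lt_trans z1_gt1.
have up : \forall t \near +oo, h t * F (y / z1 * t) <= y `^ (- alpha) + e.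
  have := tail_scaled (divr_gt0 y0 z1_gt0) => /cvgr_le; apply.
  by apply: (lt_trans g_z1); rewrite ltrD2l ltr_pdivrMr// mulr_natr mulr2n ltrDl.
have low : \forall t \near +oo, y `^ (- alpha) - e <= h t * F (y / z2 * t).
  have := tail_scaled (divr_gt0 y0 z2_gt0) => /cvgr_ge; apply.
  apply: lt_trans g_z2; rewrite ltrD2l ltrN2.
  by rewrite ltr_pdivrMr// mulr_natr mulr2n ltrDl.
have [M1 [_ upM]] := up.
near=> n.
have bn0 : 0 < b n by near: n; move/cvgryPgt : norming_cvgy; apply.
rewrite ler_distlC; apply/andP; split.
  have lown : y `^ (- alpha) - e <= h (z2 * b n) * F (y / z2 * (z2 * b n)).
    by near: n; exact: (cvg_norming_scaled z2_gt0 low).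
  have yb : y / z2 * (z2 * b n) = y * b n by field; rewrite gt_eqF.
  rewrite yb in lown; apply: (le_trans lown); rewrite ler_wpM2r//.
  rewrite leNgt; apply/negP => nh.
  have : b n <= z2 * b n.
    by apply: ge_inf; [exists 0; exact: level_lb|split; [rewrite mulr_gt0|exact: ltW]].
  by rewrite leNgt gtr_pMl// z2_lt1.
have [t [t0 nh] tb] : exists2 t, level n t & t < b n + (z1 - 1) * b n.
  apply: inf_adherent; first by rewrite mulr_gt0// subr_gt0.
  by split; [exact: level_neq0|exists 0; exact: level_lb].
have bt : b n <= t by apply: ge_inf => //; exists 0; exact: level_lb.
have tup : h t * F (y / z1 * t) <= y `^ (- alpha) + e.
  apply: upM; apply: lt_le_trans bt.
  by near: n; move/cvgryPgt : norming_cvgy; apply.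
apply: le_trans tup; apply: ler_pM => //; apply: F_noninc.
rewrite -mulrA ler_wpM2l ?ltW// mulrC ltr_pdivrMr//.
by apply: (lt_le_trans tb); rewrite mulrBl mul1r addrC subrK mulrC.
Unshelve. all: by end_near. Qed.

Lemma tail_norming_cvg0 (y : R) : 0 < y -> F (y * b n) @[n --> \oo] --> 0.
Proof.
by move=> y0; apply: (@cvg_comp _ _ _ (fun n => y * b n) F);
  [exact: cvg_norming_scaled|exact: F_cvg0].
Qed.

Lemma norming_max_prob (y : R) : 0 < y ->
  (1 - F (y * b n)) ^+ n @[n --> \oo] --> expR (- y `^ (- alpha)).
Proof.
by move=> y0; apply: cvg_exp_limit => //;
  [exact: tail_norming_cvg0|exact: norming_tail].
Qed.

(** Karamata's estimate for truncated moments of order above [alpha], by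
    doubling the truncation level: the gain [2 ^+ p] beats the loss
    [2 `^ alpha] of the tail. *)
Lemma truncated_moment_tail (p : nat) (G : R -> R) : alpha < p%:R ->
  (forall v, 0 <= v -> G v <= v ^+ p) ->
  (forall v, 0 <= v -> G (2 * v) <= G v + (2 * v) ^+ p * F v) ->
  exists2 C : R, 0 <= C & \forall v \near +oo, G v <= C * (v ^+ p * F v).
Proof.
move=> alphap Gp G2.
have pow2 : 2 ^- p < (2 : R) `^ (- alpha).
  rewrite -powR_invn// /powR gt_eqF// ltr_expR ltr_pM2r ?ltrN2//.
  by rewrite ln_gt0// ltr1n.
pose r := (2 ^- p + (2 : R) `^ (- alpha)) / 2.
have r_lt : r < 2 `^ (- alpha) by rewrite /r; lra.
have r_gt : 2 ^- p < r by rewrite /r; lra.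
have p2 : (0 : R) < 2 ^+ p by rewrite exprn_gt0.
have r0 : 0 < r by apply: lt_trans r_gt; rewrite invr_gt0.
have pr1 : 0 < 2 ^+ p * r - 1.
  have : 2 ^+ p * 2 ^- p < 2 ^+ p * r by rewrite ltr_pM2l.
  by rewrite divff ?subr_gt0// gt_eqF.
have F2 : \forall t \near +oo, r * F t < F (2 * t).
  have cF : h t * F (2 * t) * (h t * F t)^-1 @[t --> +oo] -->
      2 `^ (- alpha) * 1^-1.
    by apply: cvgM; [exact: tail_scaled|apply: cvgV => //; exact: oner_neq0].
  rewrite invr1 mulr1 in cF.
  near=> t; have : r < h t * F (2 * t) * (h t * F t)^-1.
    by near: t; exact: (cvgr_gt _ cF).
  have ht : 0 < h t by near: t; exact: h_gt0.
  rewrite invfM mulrACA divff ?gt_eqF// mul1r ltr_pdivlMr//; exact: tail_gt0.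
have [M [_ F2M]] := F2.
pose v0 := `|M| + 1.
have v00 : 0 < v0 by rewrite ltr_wpDl.
have Mv0 : M < v0 by apply: (le_lt_trans (ler_norm _)); rewrite ltrDl.
pose C := 2 ^+ p / (2 ^+ p * r - 1) + (F (2 * v0))^-1.
have C1 : 0 <= 2 ^+ p / (2 ^+ p * r - 1) by rewrite divr_ge0 ?ltW.
have C2 : 0 <= (F (2 * v0))^-1 by rewrite invr_ge0 ltW// tail_gt0.
have C0 : 0 <= C by rewrite addr_ge0.
have doubling k v : v0 <= v <= 2 ^+ k.+1 * v0 -> G v <= C * (v ^+ p * F v).
  elim: k v => [|k IH] v /andP[v0v vk].
    rewrite expr1 in vk.
    have vnn : 0 <= v by exact: le_trans (ltW v00) v0v.
    apply: (le_trans (Gp v vnn)); rewrite mulrCA ler_peMr ?exprn_ge0//.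
    apply: (@le_trans _ _ ((F (2 * v0))^-1 * F v)).
      by rewrite mulrC ler_pdivlMr ?tail_gt0// mul1r F_noninc.
    by rewrite ler_wpM2r// lerDr.
  have [v2|v2] := leP v (2 * v0).
    by apply: IH; rewrite v0v (le_trans v2)// ler_pM2r// exprS ler_peMr//
      exprn_ege1// ler1n.
  have v0h : v0 <= v / 2 by rewrite ler_pdivlMr// mulrC ltW.
  have hk : v / 2 <= 2 ^+ k.+1 * v0.
    by rewrite ler_pdivrMr// mulrAC -exprSr.
  have IHv := IH _ (introT andP (conj v0h hk)).
  set u := v / 2 in v0h hk IHv.
  have vu : v = 2 * u by rewrite /u; field.
  clearbody u.
  have u0 : 0 <= u by exact: le_trans (ltW v00) v0h.
  have Fu : r * F u < F (2 * u) by apply: F2M; exact: lt_le_trans v0h.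
  rewrite vu; apply: (le_trans (G2 u u0)).
  have Fu' : F u <= F (2 * u) / r by rewrite ler_pdivlMr// mulrC ltW.
  have up0 : 0 <= u ^+ p by rewrite exprn_ge0.
  apply: (@le_trans _ _ ((C + 2 ^+ p) * (u ^+ p * F u))).
    by rewrite exprMn mulrDl -[2 ^+ p * u ^+ p * F u]mulrA lerD2r.
  apply: (@le_trans _ _ ((C + 2 ^+ p) * (u ^+ p * (F (2 * u) / r)))).
    by rewrite !ler_wpM2l ?addr_ge0 ?(ltW p2).
  rewrite [(2 * u) ^+ p]exprMn.
  have -> : (C + 2 ^+ p) * (u ^+ p * (F (2 * u) / r)) =
      (C + 2 ^+ p) / r * (u ^+ p * F (2 * u)) by field; rewrite gt_eqF.
  have -> : C * (2 ^+ p * u ^+ p * F (2 * u)) =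
      C * 2 ^+ p * (u ^+ p * F (2 * u)) by ring.
  rewrite ler_wpM2r ?mulr_ge0// ler_pdivrMr//.
  rewrite -subr_ge0.
  have -> : C * 2 ^+ p * r - (C + 2 ^+ p) = C * (2 ^+ p * r - 1) - 2 ^+ p by ring.
  rewrite subr_ge0 -ler_pdivrMr// /C lerDl//.
exists C => //; near=> v.
have v0v : v0 <= v by near: v; exact: (nbhs_pinfty_ge (num_real _)).
apply: (doubling (Num.truncn (v / v0))); rewrite v0v/=.
rewrite -ler_pdivrMr//.
apply: (@le_trans _ _ (Num.truncn (v / v0)).+1%:R).
  by rewrite ltW// truncnS_gt.
by rewrite -natrX ler_nat ltnW// ltn_expl.
Unshelve. all: by end_near. Qed.

End tails.

(** * The maximum of the process *)

Section union_bound.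
Context d (T : measurableType d) (R : realType) (P : probability T R).

Lemma fine_probability_le (A C : set T) : measurable A -> measurable C ->
  A `<=` C -> fine (P A) <= fine (P C).
Proof.
by move=> mA mC AC; rewrite fine_le ?fin_num_measure// le_measure ?inE.
Qed.

Lemma fine_probabilityU (A C : set T) : measurable A -> measurable C ->
  fine (P (A `|` C)) <= fine (P A) + fine (P C).
Proof.
move=> mA mC; rewrite -lee_fin EFinD !fineK ?fin_num_measure//; last first.
  exact: measurableU.
exact: measureU2.
Qed.

Lemma union_bound (A : nat -> set T) (n : nat) (c : R) :
  (forall i, measurable (A i)) -> (forall i, fine (P (A i)) <= c) ->
  fine (P (\big[setU/set0]_(i < n) A i)) <= n%:R * c.
Proof.
move=> mA Ac; elim: n => [|n IH]; first by rewrite big_ord0 measure0 mul0r.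
rewrite big_ord_recr/= (le_trans (fine_probabilityU _ _))//.
  exact: bigsetU_measurable.
by rewrite -natr1 mulrDl mul1r lerD.
Qed.

End union_bound.

Section maximum.
Context d (T : measurableType d) (R : realType) (P : probability T R).
Variables (phi : int -> {RV P >-> R}) (B : int -> int -> {RV P >-> bool})
  (Z : int -> {RV P >-> nat}).
Hypothesis model : rcinar_model phi B Z.
Local Notation M := (rcinar_max B Z).

Definition immigration_tail (t : R) : R := fine (P [set w | t < (Z 0 w)%:R]).
Local Notation Ft := immigration_tail.

Definition max_cdf (n : nat) (u : R) : R := fine (P [set w | (M n w)%:R <= u]).

(** The maximum starts at [0], so the level has to be nonnegative. *)
Lemma rcinar_maxP n w (u : R) : 0 <= u ->
  (forall i, (0 < i <= n)%N -> (rcinar B Z i w)%:R <= u) <-> (M n w)%:R <= u.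
Proof.
move=> u0; have natE m : (m%:R <= u) = (m <= Num.truncn u)%N by rewrite truncn_ge_nat.
rewrite /rcinar_max natE; split=> [le_u|/bigmax_leqP_seq le_u i /andP[i0 ni]].
  apply/bigmax_leqP_seq => i; rewrite mem_index_iota ltnS => /le_u.
  by rewrite natE.
by rewrite natE; apply: le_u; rewrite // mem_index_iota i0 ltnS.
Qed.

Let measurable_nat_event (f : T -> nat) (A : set nat) : measurable_fun setT f ->
  measurable (f @^-1` A).
Proof. by move=> mf; rewrite -[X in measurable X]setTI; exact: mf. Qed.

Let measurable_M n (u : R) : measurable [set w | (M n w)%:R <= u].
Proof.
apply: (@measurable_nat_event (M n) [set m | m%:R <= u]).
exact: measurable_rcinar_max.
Qed.

Let measurable_Z i (A : set nat) : measurable (Z i @^-1` A).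
Proof. exact: measurable_nat_event. Qed.

Lemma immigration_tail_ge0 t : 0 <= Ft t. Proof. exact: fine_ge0. Qed.

Lemma immigration_tail_noninc s t : s <= t -> Ft t <= Ft s.
Proof.
move=> st; apply: fine_probability_le.
- exact: (measurable_Z 0 [set m | t < m%:R]).
- exact: (measurable_Z 0 [set m | s < m%:R]).
- by move=> w /=; exact: le_lt_trans.
Qed.

Lemma immigration_tail_compl t :
  fine (P [set w | (Z 0 w)%:R <= t]) = 1 - Ft t.
Proof.
have mA : measurable [set w | t < (Z 0 w)%:R].
  exact: (measurable_Z 0 [set m | t < m%:R]).
have -> : [set w | (Z 0 w)%:R <= t] = ~` [set w | t < (Z 0 w)%:R].
  by apply/seteqP; split=> w /=; rewrite leNgt => /negP.
rewrite probability_setC// /immigration_tail.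
by rewrite -[P _ in LHS]fineK ?fin_num_measure.
Qed.

Lemma immigration_tail_cvg0 : Ft t @[t --> +oo] --> 0.
Proof.
pose f w : R := (Z 0 w)%:R.
have mf : measurable_fun setT f.
  exact: (measurableT_comp (f := fun m : nat => m%:R : R)).
pose X : {RV P >-> R} := HB.pack f (isMeasurableFun.Build _ _ _ _ f mf).
have /fine_cvg := cvg_ccdfy0 X.
apply: cvg_trans; apply: near_eq_cvg; near=> t.
congr (fine (P _)); apply/seteqP; split=> w /=; rewrite in_itv/= andbT//.
Unshelve. all: by end_near. Qed.

Let max_immigrationE n t :
  fine (P [set w | forall i, (0 < i <= n)%N -> (Z i%:Z w)%:R <= t]) =
  (1 - Ft t) ^+ n.
Proof. by rewrite (immigration_max_prob model) immigration_tail_compl. Qed.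

Let measurable_max_immigration n (t : R) :
  measurable [set w | forall i, (0 < i <= n)%N -> (Z i%:Z w)%:R <= t].
Proof.
rewrite (_ : [set w | _] = \bigcap_(i in [set i | (0 < i <= n)%N])
  (Z i%:Z @^-1` [set m | m%:R <= t])).
  apply: fin_bigcap_measurable => [|i _]; last exact: measurable_Z.
  by apply: (@sub_finite_set _ _ `I_n.+1) => // i /= /andP[].
by apply/seteqP; split.
Qed.

Lemma max_cdf_upper n u : 0 <= u -> max_cdf n u <= (1 - Ft u) ^+ n.
Proof.
move=> u0; rewrite -max_immigrationE; apply: fine_probability_le => //.
move=> w /= /(rcinar_maxP n w u0) Xu i i_n; apply: le_trans (Xu i i_n).
rewrite ler_nat rcinarE.
by apply: (thinned_chain_ge _ (fun j => Z j%:Z w)); case/andP: i_n.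
Qed.

(** Union bound over the exceptional events of the pathwise comparison. The
    immigration of generation [i.+1] is independent of the population [i] that it
    joins, hence the product [t * Ft v]. *)
Lemma max_cdf_lower n (u v a s t : R) : 0 <= u -> 0 <= a -> a + a <= u ->
  (forall i, fine (P [set w | a < (truncated_rcinar B Z v i w)%:R]) <= s) ->
  (forall i, fine (P [set w | a < (truncated_rcinar B Z u i w)%:R]) <= t) ->
  (1 - Ft (u - (a + a))) ^+ n <= max_cdf n u + n%:R * s + n%:R * (t * Ft v).
Proof.
move=> u0 a0 au small large.
pose S i := [set w | a < (truncated_rcinar B Z v i.+1 w)%:R].
pose L i := [set w | a < (truncated_rcinar B Z u i w)%:R] `&`
  [set w | v < (Z i.+1%:Z w)%:R].
have mS i : measurable (S i).
  exact: (@measurable_truncated_rcinar_preimage _ _ _ _ B Z v i.+1 [set m | a < m%:R]).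
have mL i : measurable (L i).
  apply: measurableI.
    exact: (@measurable_truncated_rcinar_preimage _ _ _ _ B Z u i [set m | a < m%:R]).
  exact: (measurable_Z i.+1%:Z [set m | v < m%:R]).
have mUS : measurable (\big[setU/set0]_(i < n) S i) by exact: bigsetU_measurable.
have mUL : measurable (\big[setU/set0]_(i < n) L i) by exact: bigsetU_measurable.
have PL i : fine (P (L i)) <= t * Ft v.
  rewrite /L (surroundings_immigration_indep model (n := i.+1%:Z)
    [set m | v < m%:R]
    (@truncated_rcinar_surroundings _ _ _ _ phi B Z u i [set m | a < m%:R])).
  have mX : measurable (truncated_rcinar B Z u i @^-1` [set m | a < m%:R]).
    exact: measurable_truncated_rcinar_preimage.
  have mZ : measurable (Z i.+1%:Z @^-1` [set m | v < m%:R]) by exact: measurable_Z.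
  rewrite fineM ?fin_num_measure//.
  have -> : P (Z i.+1%:Z @^-1` [set m | v < m%:R]) = P (Z 0 @^-1` [set m | v < m%:R]).
    exact: ((Z_iid model).2 i.+1%:Z 0 [set m | v < m%:R]).
  by apply: ler_wpM2r; [exact: fine_ge0|exact: large].
rewrite -max_immigrationE.
apply: (@le_trans _ _ (fine (P ([set w | (M n w)%:R <= u] `|`
    \big[setU/set0]_(i < n) S i `|` \big[setU/set0]_(i < n) L i)))).
  apply: fine_probability_le => //.
    by do 2 apply: measurableU => //.
  move=> w Zu; apply: contrapT => /not_orP[/not_orP[nM nS] nL]; apply: nM => /=.
  apply/(rcinar_maxP n w u0) => i /andP[_ ni]; rewrite rcinarE.
  apply: (@thinned_chain_no_exceedance R _ _ n u v a) => //.
    move=> [//|j] /andP[_ jn]; rewrite leNgt; apply/negP => aX; apply: nS.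
    by rewrite -bigcup_mkord; exists j.
  move=> j jn vZ; rewrite leNgt; apply/negP => aX; apply: nL.
  by rewrite -bigcup_mkord; exists j.
apply: le_trans (fine_probabilityU _ _ _) _ => //; first exact: measurableU.
rewrite lerD ?union_bound//.
apply: le_trans (fine_probabilityU _ _ _) _ => //.
by rewrite lerD ?union_bound// => i; exact: small.
Qed.

Variables (alpha : R) (h : R -> R).
Hypothesis phi_lt1 : (P [set w | (phi 0 w = 1)%R] < 1)%E.
Hypothesis h_rv : regularly_varying alpha h.
Hypothesis h_tail : h t * Ft t @[t --> +oo] --> (1 : R).
Hypothesis h_bounded : exists C, forall t, 0 < t -> h t * Ft t <= C.

Local Notation b := (norming h).

Lemma max_cdf_cvg (x : R) : 0 < x ->
  max_cdf n (x * b n) @[n --> \oo] --> expR (- x `^ (- alpha)).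
Proof.
move=> x0.
have Fge0 := immigration_tail_ge0; have Fni := immigration_tail_noninc.
have F0 := immigration_tail_cvg0.
have b_cvgy := norming_cvgy Fge0 Fni F0 h_tail h_bounded.
have tail_cvg := norming_tail Fge0 Fni F0 h_rv h_tail h_bounded.
have tail_cvg0 := tail_norming_cvg0 Fge0 Fni F0 h_tail h_bounded.
have maxZ_cvg := norming_max_prob Fge0 Fni F0 h_rv h_tail h_bounded.
pose q := Num.truncn alpha.
have alphaq : alpha < q.+1%:R by exact: truncnS_gt.
have rho_lt1 := mean_survival_lt1 model phi_lt1.
have [K K0 tailX] := truncated_rcinar_tail model q rho_lt1.
pose G v := fine (truncated_moment Z q v).
have G0 v : 0 <= G v by rewrite fine_ge0// truncated_moment_ge0.
have [C C0 GC] : exists2 C : R, 0 <= C &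
    \forall v \near +oo, G v <= C * (v ^+ q.+1 * Ft v).
  apply: (truncated_moment_tail Fge0 Fni h_rv h_tail) => // v v0.
    by rewrite -lee_fin fineK ?truncated_moment_fin// truncated_moment_le.
  exact: truncated_moment_double.
apply/cvgrPdist_le => e e0.
have e40 : 0 < e / 4 by rewrite divr_gt0.
(* the single big jump has to reach the fraction [1 - (r + r)] of the level *)
have [r r0 r_e] : exists2 r : R, 0 < r < 1 / 2 &
    expR (- x `^ (- alpha)) - e / 4 < expR (- ((1 - (r + r)) * x) `^ (- alpha)).
  have cvg_r : expR (- ((1 - (r + r)) * x) `^ (- alpha)) @[r --> (0:R)^'+] -->
      expR (- ((1 - (0 + 0)) * x) `^ (- alpha)).
    apply: (@cvg_comp _ _ _ (fun r => - ((1 - (r + r)) * x) `^ (- alpha)) expR);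
      last exact: continuous_expR.
    apply: cvgN.
    apply: (@cvg_comp _ _ _ (fun r => (1 - (r + r)) * x) (fun y => y `^ (- alpha))).
      apply: cvgMl; apply: cvgB; first exact: cvg_cst.
      by apply: cvgD; apply: cvg_at_right_filter; exact: cvg_id.
    by apply: cvg_powR_base; rewrite addr0 subr0 mul1r.
  rewrite addr0 subr0 mul1r in cvg_r.
  near (0:R)^'+ => r; exists r.
    apply/andP; split; near: r; first exact: nbhs_right_gt.
    by apply: nbhs_right_lt; rewrite divr_gt0.
  by near: r; apply: (cvgr_gt _ cvg_r); rewrite gtrBl.
have [{}r0 r2] := andP r0.
(* [D l] is the limit of the bound for the small immigrations, which are those
   below [l * x * b n] *)
pose D l := K * C / r ^+ q.+1 * x `^ (- alpha) * l `^ (q.+1%:R - alpha).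
have [l l0 l_e] : exists2 l : R, 0 < l & D l < e / 4.
  have cvg_l : D l @[l --> (0:R)^'+] -->
      K * C / r ^+ q.+1 * x `^ (- alpha) * 0.
    by apply: cvgMr; apply: powR_cvg0; rewrite subr_gt0.
  rewrite mulr0 in cvg_l.
  near (0:R)^'+ => l; exists l; first by near: l; exact: nbhs_right_gt.
  by near: l; apply: (cvgr_lt _ cvg_l).
have scaled (c : R) : 0 < c -> c * b n @[n --> \oo] --> +oo.
  move=> c0; apply: (@cvg_comp _ _ _ (fun n => b n) (fun t => c * t)) => //.
  by apply: gt0_cvgMry => //; exact: cvg_id.
have lx0 : 0 < l * x by rewrite mulr_gt0.
have y0 : 0 < (1 - (r + r)) * x by rewrite mulr_gt0//; lra.
pose small n := K * C / r ^+ q.+1 * l ^+ q.+1 * (n%:R * Ft (l * x * b n)).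
pose large n := K * C / r ^+ q.+1 * Ft (x * b n) * (n%:R * Ft (l * x * b n)).
have small_cvg : small n @[n --> \oo] --> D l.
  have -> : D l = K * C / r ^+ q.+1 * l ^+ q.+1 * (l * x) `^ (- alpha).
    rewrite /D powRM ?ltW// powRB ?gt_eqF ?implybT// powRN powR_mulrn ?ltW//.
    by rewrite powRN; ring.
  by apply: cvgMr; exact: tail_cvg.
have large_cvg : large n @[n --> \oo] --> 0.
  have -> : 0 = K * C / r ^+ q.+1 * 0 * (l * x) `^ (- alpha) by rewrite mulr0 mul0r.
  apply: cvgM; last exact: tail_cvg.
  by apply: cvgMr; exact: tail_cvg0.
near=> n.
have bn0 : 0 < b n by near: n; move/cvgryPgt : b_cvgy; apply.
have xb0 : 0 < x * b n by rewrite mulr_gt0.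
have a0 : 0 < r * (x * b n) by rewrite mulr_gt0.
have lxb0 : 0 < l * x * b n by rewrite mulr_gt0.
have up : max_cdf n (x * b n) <= expR (- x `^ (- alpha)) + e.
  apply: le_trans (max_cdf_upper n (ltW xb0)) _.
  by near: n; apply: (cvgr_le _ (maxZ_cvg x x0)); rewrite ltrDl.
have moment_ratio (c : R) : 0 < c ->
    G (c * (x * b n)) <= C * ((c * (x * b n)) ^+ q.+1 * Ft (c * (x * b n))) ->
    K * G (c * (x * b n)) / (r * (x * b n)) ^+ q.+1 <=
    K * C / r ^+ q.+1 * c ^+ q.+1 * Ft (c * (x * b n)).
  move=> c0 Gc; rewrite ler_pdivrMr ?exprn_gt0//.
  apply: (@le_trans _ _ (K * (C * ((c * (x * b n)) ^+ q.+1 * Ft (c * (x * b n)))))).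
    by rewrite ler_wpM2l.
  rewrite le_eqVlt; apply/orP; left; apply/eqP; rewrite !exprMn.
  by field; rewrite gt_eqF// exprn_gt0.
have low : (1 - Ft ((1 - (r + r)) * x * b n)) ^+ n <=
    max_cdf n (x * b n) + small n + large n.
  have -> : (1 - (r + r)) * x * b n = x * b n - (r * (x * b n) + r * (x * b n)) by ring.
  apply: le_trans (@max_cdf_lower n (x * b n) (l * (x * b n)) (r * (x * b n))
    (K * G (l * (x * b n)) / (r * (x * b n)) ^+ q.+1)
    (K * G (x * b n) / (r * (x * b n)) ^+ q.+1) _ _ _ _ _) _.
  - exact: ltW.
  - exact: ltW.
  - by rewrite -mulrDl -[leRHS]mul1r ler_wpM2r ?(ltW xb0)//; lra.
  - by move=> i; apply: tailX => //; rewrite mulr_ge0 ?ltW.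
  - by move=> i; apply: tailX => //; exact: ltW.
  - rewrite -!addrA lerD2l lerD//.
      rewrite /small [leRHS]mulrCA ler_wpM2l// -(mulrA l x (b n)).
      apply: moment_ratio => //; rewrite [l * (x * b n)]mulrA.
      by near: n; exact: (scaled _ lx0 _ GC).
    rewrite /large [leRHS]mulrCA ler_wpM2l// -(mulrA l x (b n)) ler_wpM2r//.
    have := moment_ratio 1 ltr01; rewrite mul1r expr1n mulr1; apply.
    by near: n; exact: (scaled _ x0 _ GC).
rewrite ler_distlC up andbT.
have low_lim : expR (- x `^ (- alpha)) - e / 4 <= (1 - Ft ((1 - (r + r)) * x * b n)) ^+ n.
  by near: n; exact: (cvgr_ge _ (maxZ_cvg _ y0)).
have small_lim : small n <= e / 4 by near: n; exact: (cvgr_le _ small_cvg).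
have large_lim : large n <= e / 4 by near: n; exact: (cvgr_le _ large_cvg).
by lra.
Unshelve. all: by end_near. Qed.

End maximum.

(** * The limit law *)

Section frechet.
Variables (R : realType) (alpha : R).
Hypothesis alpha_gt0 : 0 < alpha.

Definition frechet (x : R) : R :=
  if 0 < x then expR (- x `^ (- alpha)) else 0.

Lemma frechet_ge0 x : 0 <= frechet x.
Proof. by rewrite /frechet; case: ifP => // _; exact: expR_ge0. Qed.

Lemma frechet_nondecreasing : nondecreasing frechet.
Proof.
move=> x y xy; rewrite {1}/frechet; case: ltP => x0; last exact: frechet_ge0.
have y0 := lt_le_trans x0 xy; rewrite /frechet y0 ler_expR lerN2 !powRN.
by rewrite lef_pV2 ?posrE ?powR_gt0// (ge0_ler_powR (ltW alpha_gt0))// nnegrE ltW.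
Qed.

(** From [expR (- y) <= 1 / (1 + y) <= 1 / y] with [y = x `^ (- alpha)]. *)
Lemma frechet_le_powR x : 0 < x -> frechet x <= x `^ alpha.
Proof.
move=> x0; rewrite /frechet x0 expRN powRN -[leRHS]invrK.
rewrite lef_pV2 ?posrE ?expR_gt0 ?invr_gt0 ?powR_gt0//.
by apply: le_trans (expR_ge1Dx _); rewrite lerDr.
Qed.

Lemma frechet_ge_powR x : 0 < x -> 1 - x `^ (- alpha) <= frechet x.
Proof. by move=> x0; rewrite /frechet x0; exact: expR_ge1Dx. Qed.

Lemma frechet_right_continuous : right_continuous frechet.
Proof.
move=> x; have [x0|x0] := ltP 0 x.
  have fx : frechet x = expR (- x `^ (- alpha)) by rewrite /frechet x0.
  apply: cvg_at_right_filter; rewrite fx.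
  have : expR (- y `^ (- alpha)) @[y --> x] --> expR (- x `^ (- alpha)).
    apply: (@cvg_comp _ _ _ (fun y => - y `^ (- alpha)) expR);
      last exact: continuous_expR.
    by apply: cvgN; exact: cvg_powR_base.
  apply: cvg_trans; apply: near_eq_cvg; near=> y.
  by rewrite /frechet ifT//; near: y; exact: lt_nbhsr.
have fx0 : frechet x = 0 by rewrite /frechet ltNge x0.
rewrite fx0; move: x0; rewrite le_eqVlt => /orP[/eqP ->|x0].
  apply: (@squeeze_cvgr _ _ _ _ (cst 0) (fun y => y `^ alpha)).
  - by near=> y; rewrite frechet_ge0 frechet_le_powR//.
  - exact: cvg_cst.
  - exact: powR_cvg0.
apply: cvg_at_right_filter.
have : cst 0 y @[y --> x] --> (0 : R) by exact: cvg_cst.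
apply: cvg_trans; apply: near_eq_cvg; near=> y.
rewrite /frechet ifF//; apply/negbTE; rewrite -leNgt ltW//.
by near: y; exact: lt_nbhsl.
Unshelve. all: by end_near. Qed.

Lemma frechet_cvgNy : frechet @ -oo --> (0 : R).
Proof.
have : (cst 0 : R -> R) @ -oo --> (0 : R) by exact: cvg_cst.
apply: cvg_trans; apply: near_eq_cvg; near=> y.
rewrite /frechet ifF//; apply/negbTE; rewrite -leNgt.
by near: y; exact: (nbhs_ninfty_le (num_real _)).
Unshelve. all: by end_near. Qed.

Lemma frechet_le1 x : frechet x <= 1.
Proof.
rewrite /frechet; case: ifP => // x0.
by rewrite -[leRHS]expR0 ler_expR oppr_le0 powR_ge0.
Qed.

Lemma frechet_cvgy : frechet @ +oo --> (1 : R).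
Proof.
apply/cvgrPdist_le => e e0.
near=> x.
have x0 : 0 < x by near: x; exact: (nbhs_pinfty_gt (num_real _)).
rewrite ler_distlC; apply/andP; split; last first.
  by apply: le_trans (frechet_le1 x) _; rewrite lerDl ltW.
apply: le_trans (frechet_ge_powR x0); rewrite lerD2l lerN2 powRN.
rewrite -[leRHS]invrK lef_pV2 ?posrE ?invr_gt0 ?powR_gt0//.
apply: (@le_trans _ _ ((e^-1 `^ alpha^-1) `^ alpha)).
  by rewrite -powRrM mulVf ?gt_eqF// powRr1// invr_ge0 ltW.
apply: (ge0_ler_powR (ltW alpha_gt0)); rewrite ?nnegrE ?powR_ge0 ?(ltW x0) ?ltW//.
Unshelve. all: by end_near. Qed.

Definition frechet_cumulative : cumulativeBounded (0 : R) (1 : R) :=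
  HB.pack frechet
    (isCumulative.Build R _ R frechet frechet_nondecreasing frechet_right_continuous)
    (isCumulativeBounded.Build R 0 1 frechet frechet_cvgNy frechet_cvgy).

Lemma frechet_rv :
  exists X : {RV (lebesgue_stieltjes_measure frechet_cumulative) >-> R},
    forall x, cdf X x = (frechet x)%:E.
Proof. by eexists => x; exact: cdf_lebesgue_stieltjes_id. Qed.

End frechet.

(** * Convergence of the scaled maximum *)

Theorem theorem2p6 (R : realType) (d : measure_display) (T : measurableType d)
    (P : probability T R) (phi : int -> {RV P >-> R})
    (B : int -> int -> {RV P >-> bool}) (Z : int -> {RV P >-> nat})
    (alpha : R) (h : R -> R)
    (model : rcinar_model phi B Z)
    (phi_lt1 : (P [set w | (phi 0 w = 1)%R] < 1)%E)
    (alpha_gt0 : 0 < alpha)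
    (h_rv : regularly_varying alpha h)
    (h_tail : h t * fine (P [set w | t < (Z 0 w)%:R]) @[t --> +oo]
              --> (1 : R))
    (h_sup : (ereal_sup
        [set (h t * fine (P [set w | (t < (Z 0 w)%:R)%R]))%:E
        | t in [set t : R | (0 < t)%R]] < +oo)%E) :
  exists (d' : measure_display) (T' : measurableType d')
         (P' : probability T' R) (Minf : {RV P' >-> R}),
    (forall x : R, 0 < x -> cdf Minf x = (expR (- (x `^ (- alpha))))%:E) /\
    cvg_in_distribution
      (fun n => scaled_max B Z (norming h n) n : {RV P >-> R}) Minf.
Proof.
have h_bounded : exists C, forall t, 0 < t -> h t * immigration_tail Z t <= C.
  move: h_sup; set S := [set _ | _ in _].
  have SS t : 0 < t -> ((h t * immigration_tail Z t)%:E <= ereal_sup S)%E.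
    by move=> t0; apply: ereal_sup_ubound; exists t.
  case: (ereal_sup S) SS => [c|//|] SS _.
    by exists c => t /SS; rewrite lee_fin.
  by exists 0 => t /SS; rewrite leeNy_eq.
have max_cvg := max_cdf_cvg model phi_lt1 h_rv h_tail h_bounded.
have b_cvgy := norming_cvgy (immigration_tail_ge0 Z) (immigration_tail_noninc Z)
  (immigration_tail_cvg0 Z) h_tail h_bounded.
have b_gt0 : \forall n \near \oo, 0 < norming h n by move/cvgryPgt : b_cvgy; apply.
have [X cdfE] := frechet_rv alpha_gt0.
exists _, _, _, X; split=> [x x0|x _]; first by rewrite cdfE /frechet x0.
rewrite cdfE; apply: cvg_EFin.
  by near=> n; rewrite fin_num_measure.
have cdf_max n y : 0 < norming h n ->
    fine (cdf (scaled_max B Z (norming h n) n : {RV P >-> R}) y) =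
    max_cdf B Z n (y * norming h n).
  move=> bn; congr (fine (P _)); apply/seteqP.
  by split=> w /=; rewrite in_itv/= /scaled_max ler_pdivrMr.
have [x0|x0] := ltP 0 x.
  have := max_cvg x x0; rewrite /frechet x0.
  apply: cvg_trans; apply: near_eq_cvg; near=> n.
  by rewrite /= cdf_max//; near: n.
(* at nonpositive points, the distribution functions are dominated by their
   values at any [y > 0], whose limit is small when [y] is *)
rewrite /frechet ltNge x0/=; apply/cvgrPdist_le => e e0.
have [y y0 ye] : exists2 y : R, 0 < y & expR (- y `^ (- alpha)) < e.
  have f0 : frechet alpha 0 = 0 :> R by rewrite /frechet ltxx.
  have cvg0 : frechet alpha @ 0^'+ --> frechet alpha 0.
    exact: frechet_right_continuous.
  rewrite f0 in cvg0.
  near (0:R)^'+ => y; exists y; first by near: y; exact: nbhs_right_gt.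
  have y0 : 0 < y by near: y; exact: nbhs_right_gt.
  have : frechet alpha y < e by near: y; exact: (cvgr_lt _ cvg0).
  by rewrite /frechet y0.
near=> n; rewrite sub0r normrN ger0_norm; last exact: fine_ge0.
have bn : 0 < norming h n by near: n.
apply: (@le_trans _ _ (max_cdf B Z n (y * norming h n))).
  rewrite -cdf_max//= fine_le ?fin_num_measure//.
  by apply: cdf_nondecreasing; rewrite (le_trans x0)// ltW.
by near: n; exact: (cvgr_le _ (max_cvg y y0)).
Unshelve. all: by end_near. Qed.
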